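(* Fix $k\in\mathbb N$. For $x,m\in\mathbb R^+$ let $h_m(x)=x\mathbf 1_{x\ge m}$. Then $$\lim_{m\to\infty}\ \sup_{\mathcal D\in\Omega_{\mathcal D}:\,N^{\mathcal D}\ge 2k}\ \mathbb E\left[h_m\left(\frac{\square_{\square,k}(T^{\mathcal D})}{(\lambda^{\mathcal D})^k}\right)\right]=0 .$$
   Context: $\mathbb N=\{1,2,\dots\}$. The labels $V_i$ ($i\ge1$) and $\star_i$ ($i\ge0$) are all distinct. $\Omega_{\mathcal D}$ is the set of finite nonincreasing sequences $\mathcal D=(d_1,\dots,d_s)$ of nonnegative integers with $\sum_{i=1}^sd_i=s-2$. Put $s^{\mathcal D}=s$, $N^{\mathcal D}=\#\{i\le s:d_i=0\}-2$, $(\sigma^{\mathcal D})^2=\sum_{i=1}^sd_i(d_i-1)$, $\lambda^{\mathcal D}=\sigma^{\mathcal D}/s^{\mathcal D}$. A $\mathcal D$-tree $T^{\mathcal D}$ is a uniform random tree among all trees with vertex set $\{V_i:d_i>0\}\cup\{\star_i\}_{0\le i\le N^{\mathcal D}+1}$ such that $\deg V_i=d_i+1$ for every $i$ with $d_i>0$ and each $\star_i$ is a leaf. Multigraphs may have loops and multiple edges; $\#_{v,w}(G)$ is the number of edges $\{v,w\}$ in $G$. For leaves $L_1\ne L_2$ of $G$ with neighbours $F_1,F_2$, gluing $L_1$ and $L_2$ means deleting $L_1,L_2$ and their edges and adding one edge $\{F_1,F_2\}$ (a loop if $F_1=F_2$). $\mathcal G_{(\star_1,\star_2),\dots,(\star_{2i-1},\star_{2i})}$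 glues successively the listed pairs of leaves. $\square(G)$ is the number of edges $e$ of $G$ (with multiplicity) such that $G$ minus $e$ is connected. $\circ(G)=\prod_v2^{\#_{v,v}(G)}\prod_{\{v,w\}}\#_{v,w}(G)!$, the second product being over unordered pairs of vertices, $v=w$ included. For a tree $T$ having $\star_1,\dots,\star_{2k}$ among its leaves, $$\square_i(T)=\square(\mathcal G_{(\star_1,\star_2),\dots,(\star_{2i-1},\star_{2i})}(T)),\qquad \square_{\square,k}(T)=\frac{\circ(\mathcal G_{(\star_1,\star_2),\dots,(\star_{2k-1},\star_{2k})}(T))}{\prod_{i=1}^k\square_i(T)}.$$ *)

(* Defs.v *)
From HB Require Import structures.
From mathcomp Require Import all_boot all_order all_algebra.
From mathcomp Require Import all_classical all_reals all_analysis.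

Set Implicit Arguments.
Unset Strict Implicit.
Unset Printing Implicit Defensive.

Import Order.TTheory GRing.Theory Num.Theory numFieldNormedType.Exports.

Local Open Scope nat_scope.

Section Multigraphs.
Variable V : finType.

(* The unordered pair {v,w}; it is the singleton {v} when v = w. *)
Definition upair (v w : V) : {set V} := [set v; w]%SET.

Definition is_upair (e : {set V}) : bool := 0 < #|e| <= 2.

(* A finite multigraph with vertices in V: [mult G e] is the number of edges
   with endpoint set e, loops being singletons.  Only the values at unordered
   pairs contained in [verts G] are meaningful. *)
Record multigraph := Multigraph {
  verts : {set V};
  mult : {set V} -> nat
}.

Implicit Types (G : multigraph) (v w L : V) (e : {set V}).

Definition nedges G v w : nat := mult G (upair v w).

Definition adj G : rel V :=
  fun v w => [&& v \in verts G, w \in verts G & 0 < nedges G v w].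

Definition connected_mg G : bool :=
  (verts G != finset.set0) &&
  [forall v in verts G, forall w in verts G, connect (adj G) v w].

Definition remove_edge G e : multigraph :=
  Multigraph (verts G) (fun e' => mult G e' - (e' == e)).

Definition square G : nat :=
  \sum_(e : {set V} |
      [&& e \subset verts G, is_upair e & connected_mg (remove_edge G e)])
    mult G e.

Definition circ G : nat :=
  (\prod_(v in verts G) 2 ^ nedges G v v) *
  (\prod_(e : {set V} | (e \subset verts G) && is_upair e) (mult G e)`!).

(* The neighbour of a leaf L; the default value L is junk, used only if L has
   no neighbour. *)
Definition neighbour G L : V := odflt L [pick w | adj G L w].

(* Meaningful when L1 and L2 are distinct non-adjacent leaves of G. *)
Definition glue G (L : V * V) : multigraph :=
  Multigraph (verts G :\: [set L.1; L.2])%SET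
    (fun e => if (L.1 \in e) || (L.2 \in e) then 0
              else mult G e
                   + (e == upair (neighbour G L.1) (neighbour G L.2))).

Definition glue_all G (Ls : seq (V * V)) : multigraph := foldl glue G Ls.

(* Simple graphs on the whole of V are given by their edge sets. *)
Definition simple_mg (T : {set {set V}}) : multigraph :=
  Multigraph [set: V]%SET (fun e => e \in T).

Definition deg (T : {set {set V}}) v : nat := #|[set e in T | v \in e]%SET|.

Definition is_tree (T : {set {set V}}) : bool :=
  [&& [forall e in T, #|e| == 2],
      connected_mg (simple_mg T) &
      `[< forall c : seq V, ucycle (adj (simple_mg T)) c -> size c <= 2 >]].

Variable star : nat -> V.

Definition star_pairs (i : nat) : seq (V * V) :=
  [seq (star (2 * j - 1), star (2 * j)) | j <- iota 1 i].

Definition square_at (i : nat) (T : {set {set V}}) : nat :=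
  square (glue_all (simple_mg T) (star_pairs i)).

Definition square_square (R : realType) (k : nat) (T : {set {set V}}) : R :=
  ((circ (glue_all (simple_mg T) (star_pairs k)))%:R /
   \prod_(1 <= i < k.+1) (square_at i T)%:R)%R.

End Multigraphs.

(* Membership in Omega_D; the equation sum d_i = s - 2 is over the integers,
   so it forces s >= 2. *)
Definition degree_sequence (D : seq nat) : Prop :=
  sorted geq D /\ (\sum_(d <- D) d) + 2 = size D.

(* At least two entries of a degree sequence vanish, so that the truncated
   subtraction is harmless. *)
Definition nstars (D : seq nat) : nat := count_mem 0 D - 2.

Definition sigma (R : realType) (D : seq nat) : R :=
  Num.sqrt (\sum_(d <- D) (d * (d - 1)))%:R%R.

Definition lambda (R : realType) (D : seq nat) : R :=
  (sigma R D / (size D)%:R)%R.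

(* [inl i] is the label V_(i+1) (indices start at 0 here, so that
   d_(i+1) = nth 0 D i) and [inr j] is the label star_j. *)
Definition label (D : seq nat) : finType :=
  ({i : 'I_(size D) | 0 < nth 0 D i} + 'I_(nstars D).+2)%type.

(* [inord] returns ord0 outside the range 0 <= j <= nstars D + 1. *)
Definition star_of (D : seq nat) (j : nat) : label D := inr (inord j).

Definition is_Dtree (D : seq nat) (T : {set {set label D}}) : bool :=
  [&& is_tree T,
      [forall i : {i : 'I_(size D) | 0 < nth 0 D i},
         deg T (inl i) == (nth 0 D (val i)).+1] &
      [forall j : 'I_(nstars D).+2, deg T (inr j) == 1]].

(* Expectation of f at a uniform element of the finite set {x | P x}. *)
Definition unif_expectation (R : realType) (A : finType) (P : pred A)
    (f : A -> R) : R :=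
  ((\sum_(x | P x) f x) / #|P|%:R)%R.

Definition hcut (R : realType) (m x : R) : R :=
  (if (m <= x)%R then x else 0)%R.

(* Main.v *)
(* Let y_i = 1 / (lambda square_i(T)). Gluing k pairs of leaves multiplies
   circ by at most (2(k+1))^k, so the random variable is at most C prod_i y_i,
   and it suffices to bound E[prod_i y_i^(3/2)] uniformly in D: the truncated
   expectation is then O(m^(-1/2)). The exponent 3/2 lies in the window (1,2):
   a path of length b joins star_(2i-1) to star_(2i) with probability about
   b lambda^2, so that the second moment diverges logarithmically.

   After gluing the i-th pair, the inner vertices of the tree path between its
   two leaves form a cycle, so square_i(T) is at least their number. The pairs
   are explored one after the other. Given the forest F formed by the paths
   found so far, T/F is again a uniform tree with prescribed degrees, by the
   formula (c-2)! prod_C R_C / prod_v r_v! for the number of trees containing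
   a forest F with c components, where r_v is the degree missing at v and R_C
   its sum over the component C. Contracting F only shortens paths, and it
   replaces sigma by some A >= sigma. Paths with more than |V| / (L A) vertices
   contribute at most a multiple of (A/sigma)^2. Adding a path with b inner
   components multiplies the number of trees, summed over all such paths, by
   O(b A^2 / |V|^2), and increases A by a quantity all of whose moments under
   this sum are of the order of powers of A. Hence the bound
   K^n (A/sigma)^(2n) when n pairs remain, by induction on n. *)
Require Import Defs.
From HB Require Import structures.
From mathcomp Require Import all_boot all_order all_algebra.
From mathcomp Require Import zify ring lra reals.

Set Implicit Arguments.
Unset Strict Implicit.
Unset Printing Implicit Defensive.

Import Order.TTheory GRing.Theory Num.Theory.

(** * Forests and their components *)

Local Open Scope nat_scope.

Section EdgeSets.
Variable V : finType.
Implicit Types (F E T : {set {set V}}) (e C : {set V}) (u v w x y : V).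

Definition lnk F : rel V := fun u v => [set u; v] \in F.

Definition conn F : rel V := connect (lnk F).

Definition cmp F u : {set V} := [set w | conn F u w].

Definition comps F : {set {set V}} := [set cmp F u | u in V].

Definition ncomps F := #|comps F|.

Definition loopless F := [forall e in F, #|e| == 2].

(** Acyclicity is encoded by the Euler relation, which suits counting; [forestP] recovers the
    description by edges whose removal disconnects their endpoints. *)
Definition forest F := loopless F && (#|F| + ncomps F == #|V|).

Lemma lnk_sym F : symmetric (lnk F).
Proof. by move=> u v; rewrite /lnk setUC. Qed.

Lemma conn_sym F : symmetric (conn F).
Proof. exact/sym_connect_sym/lnk_sym. Qed.

Lemma conn0 F u : conn F u u. Proof. exact: connect0. Qed.

Lemma conn_trans F : transitive (conn F).
Proof. exact: connect_trans. Qed.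

Lemma conn1 F u v : [set u; v] \in F -> conn F u v.
Proof. exact: connect1. Qed.

Lemma conn_sub F E u v : F \subset E -> conn F u v -> conn E u v.
Proof.
move=> sFE; apply: connect_sub => a b ab.
by apply: connect1; exact: (subsetP sFE).
Qed.

Lemma cmp_eqP F u v : reflect (cmp F u = cmp F v) (conn F u v).
Proof.
apply: (iffP idP) => [uv|/setP/(_ v)]; last by rewrite !inE conn0.
apply/setP=> w; rewrite !inE; apply/idP/idP; last exact: conn_trans.
by apply: conn_trans; rewrite conn_sym.
Qed.

Lemma cmp_eq F u v : (cmp F u == cmp F v) = conn F u v.
Proof. by apply/eqP/cmp_eqP. Qed.

Lemma mem_cmp F u : u \in cmp F u. Proof. by rewrite inE conn0. Qed.

Lemma cmp_in F u : cmp F u \in comps F. Proof. exact: imset_f. Qed.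

Lemma mem_comps F C u : C \in comps F -> (u \in C) = (C == cmp F u).
Proof. by case/imsetP=> w _ ->; rewrite inE cmp_eq. Qed.

(** The components partition the vertices. The summand may depend on the component too, which lets
    sums over crossing points be regrouped. *)
Lemma comps_big (R : Type) (idx : R) (op : Monoid.com_law idx) F
    (f : {set V} -> V -> R) :
  \big[op/idx]_v f (cmp F v) v =
  \big[op/idx]_(C in comps F) \big[op/idx]_(v in C) f C v.
Proof.
rewrite (partition_big (cmp F) (mem (comps F))) /= => [|v _]; last exact: cmp_in.
apply: eq_bigr => C CF; apply: eq_big => [v|v /eqP-> //].
by rewrite (mem_comps _ CF) eq_sym.
Qed.

Lemma conn_add F x y u v :
  conn ([set x; y] |: F) u v =
  [|| conn F u v, conn F u x && conn F y v | conn F u y && conn F x v].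
Proof.
set F' := _ |: F.
have sF : F \subset F' by exact: subsetUr.
have xy : conn F' x y by apply: conn1; rewrite setU11.
apply/idP/idP; last first.
  case/or3P=> [/(conn_sub sF)//|/andP[ux yv]|/andP[uy xv]].
    apply: conn_trans (conn_sub sF ux) _.
    exact: conn_trans xy (conn_sub sF yv).
  apply: conn_trans (conn_sub sF uy) _.
  by apply: conn_trans (conn_sub sF xv); rewrite conn_sym.
case/connectP=> p; elim: p u => [|w p IHp] u /=; first by move=> _ ->; rewrite conn0.
case/andP=> uw pw lw; have := IHp _ pw lw; move: uw.
rewrite /lnk !inE => /orP[/eqP uwE|uw].
  have : (u \in [set x; y]) && (w \in [set x; y]) by rewrite -uwE !inE !eqxx orbT.
  rewrite !inE => /andP[/orP[]/eqP-> /orP[]/eqP->] //; rewrite ?conn0 /=.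
  - by case/or3P=> [->|/andP[? ->]|->]; rewrite ?orbT.
  - by case/or3P=> [->|->|/andP[? ->]]; rewrite ?orbT.
have uw1 := conn1 uw.
case/or3P=> [H|/andP[wx ->]|/andP[wy ->]].
- by rewrite (conn_trans uw1 H).
- by rewrite (conn_trans uw1 wx) !orbT.
- by rewrite (conn_trans uw1 wy) !orbT.
Qed.

Lemma cmp_add F x y u : cmp ([set x; y] |: F) u =
  if (conn F u x) || (conn F u y) then cmp F x :|: cmp F y else cmp F u.
Proof.
apply/setP=> w; rewrite inE conn_add.
case: ifP => [/orP[]|/negbT]; rewrite ?inE.
- rewrite -!(cmp_eq F) => /eqP->; rewrite eqxx /=.
  by do 3!case: (_ == _).
- rewrite -!(cmp_eq F) => /eqP->; rewrite eqxx /=.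
  by do 3!case: (_ == _).
- by rewrite negb_or => /andP[/negbTE-> /negbTE->]; rewrite !orbF.
Qed.

Lemma comps_add_conn F x y : conn F x y -> comps ([set x; y] |: F) = comps F.
Proof.
move=> xy; apply: eq_imset => u; rewrite cmp_add.
case: ifP => // h.
have -> : cmp F y = cmp F x by apply/esym/cmp_eqP.
rewrite setUid; apply/cmp_eqP; rewrite conn_sym.
by case/orP: h => // uy; apply: conn_trans uy _; rewrite conn_sym.
Qed.

Lemma comps_add F x y : ~~ conn F x y ->
  comps ([set x; y] |: F) =
  (cmp F x :|: cmp F y) |: (comps F :\ cmp F x :\ cmp F y).
Proof.
move=> xy; apply/setP=> C; rewrite !inE; apply/idP/idP.
  case/imsetP=> u _ ->; rewrite cmp_add; case: ifP => [_|/negbT]; first by rewrite eqxx.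
  by rewrite negb_or !cmp_eq => /andP[-> ->]; rewrite cmp_in orbT.
case/orP=> [/eqP->|/and3P[Cy Cx /imsetP[u _ Cu]]].
  by apply/imsetP; exists x => //; rewrite cmp_add conn0.
apply/imsetP; exists u => //; rewrite cmp_add.
by move: Cx Cy; rewrite Cu !cmp_eq => /negbTE-> /negbTE->.
Qed.

Lemma cmp_addN F x y : ~~ conn F x y ->
  cmp F x :|: cmp F y \notin comps F :\ cmp F x :\ cmp F y.
Proof.
move=> xy; rewrite !inE; apply/negP=> /and3P[_ hx hF]; case/negP: hx.
by rewrite -(mem_comps _ hF) inE mem_cmp.
Qed.

Lemma ncomps_add F x y : ~~ conn F x y ->
  ncomps F = (ncomps ([set x; y] |: F)).+1.
Proof.
move=> xy; rewrite /ncomps comps_add // cardsU1 cmp_addN //.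
rewrite (cardsD1 (cmp F x)) cmp_in (cardsD1 (cmp F y) (_ :\ _)).
by rewrite !inE cmp_in eq_sym cmp_eq xy.
Qed.

Lemma loopless_setU1 F e : loopless (e |: F) = (#|e| == 2) && loopless F.
Proof.
apply/idP/andP.
  move/forall_inP=> h; split; first by apply: h; rewrite setU11.
  by apply/forall_inP=> f fF; apply: h; rewrite setU1r.
case=> e2 /forall_inP h; apply/forall_inP=> f; rewrite in_setU1.
by case/orP=> [/eqP->//|/h].
Qed.

Lemma loopless_sub F E : F \subset E -> loopless E -> loopless F.
Proof.
by move=> /subsetP s /forall_inP h; apply/forall_inP=> f fF; apply/h/s.
Qed.

Lemma looplessP F e : loopless F -> e \in F -> exists u v, u != v /\ e = [set u; v].
Proof.
move=> /forall_inP h /h /cards2P[u [v uv]]; by exists u, v.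
Qed.

Lemma ncomps_set0 : ncomps set0 = #|V|.
Proof.
rewrite /ncomps card_imset // => u v /eqP; rewrite cmp_eq => /connectP[[|w p]] //=.
by rewrite /lnk inE.
Qed.

Lemma ncomps_setU1 F e : #|e| = 2 -> ncomps F <= (ncomps (e |: F)).+1.
Proof.
move=> /eqP/cards2P[x [y [_ ->]]]; case xy: (conn F x y).
  by rewrite /ncomps comps_add_conn.
by rewrite (@ncomps_add F x y) ?xy.
Qed.

Lemma edge_set_ind (P : {set {set V}} -> Prop) F E :
  P F ->
  (forall E' e, F \subset E' -> e \in E -> e \notin E' -> E' \subset E ->
    P E' -> P (e |: E')) ->
  F \subset E -> P E.
Proof.
move=> PF IH; have [n] := ubnP #|E :\: F|.
(* Generalizes to all sets between [F] and [E], so that the edges outside [F] can be removed one at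
   a time. *)
suff: forall n E', #|E' :\: F| < n -> F \subset E' -> E' \subset E -> P E'.
  by move=> h lt FE; apply: (h n).
move=> {}n; elim: n => // n IHn E' le FE' EE'.
have [h|/set0Pn[e]] := eqVneq (E' :\: F) set0.
  have -> // : E' = F.
  by apply/eqP; rewrite eqEsubset FE' -setD_eq0 h eqxx.
rewrite inE => /andP[eF eE']; rewrite -(setD1K eE').
have FE1 : F \subset E' :\ e.
  by apply/subsetP=> f fF; rewrite !inE (subsetP FE' f fF) andbT; apply: contraNneq eF => <-.
apply: IH => //; rewrite ?setD11 ?(subsetP EE') //.
  exact: subset_trans (subD1set _ _) EE'.
apply: IHn => //; last exact: subset_trans (subD1set _ _) EE'.
rewrite setDDl setUC -setDDl; move: le; rewrite (cardsD1 e (E' :\: F)) inE eF eE' /=.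
by [].
Qed.

(** An added edge merges at most two components, so it lowers [ncomps] by at most one. *)
Lemma ncomps_le F E : F \subset E -> loopless E -> ncomps F + #|F| <= ncomps E + #|E|.
Proof.
move=> sFE lE; pose P E := ncomps F + #|F| <= ncomps E + #|E|.
apply: (@edge_set_ind P F E); rewrite /P // => E' e _ eE eE' _.
move/leq_trans; apply; rewrite cardsU1 eE' addnA addn1 leq_add2r.
by apply: ncomps_setU1; apply/eqP; move/forall_inP: lE; apply.
Qed.

Lemma ncomps_geq F : loopless F -> #|V| <= ncomps F + #|F|.
Proof.
by move=> lF; have := ncomps_le (sub0set F) lF; rewrite ncomps_set0 cards0 addn0.
Qed.

(** Components plus edges is monotone and at least [#|V|]; equality for [E] forces equality for
    [F]. *)
Lemma forest_sub F E : F \subset E -> forest E -> forest F.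
Proof.
move=> s /andP[lE /eqP hE]; have lF := loopless_sub s lE.
rewrite /forest lF eqn_leq addnC (ncomps_geq lF) andbT.
by have := ncomps_le s lE; rewrite (addnC (ncomps E)) hE.
Qed.

Lemma forest_set0 : forest set0.
Proof.
rewrite /forest cards0 ncomps_set0 eqxx andbT; apply/forall_inP=> e.
by rewrite inE.
Qed.

Lemma forest_add F u v : forest F -> ~~ conn F u v -> forest ([set u; v] |: F).
Proof.
move=> /andP[lF /eqP hF] uv; rewrite /forest loopless_setU1 lF andbT cards2.
have -> : u != v by apply: contraNneq uv => ->; rewrite conn0.
rewrite cardsU1 -hF (ncomps_add uv) addnS.
by rewrite (contraNN _ uv) //=; exact: conn1.
Qed.

(** Otherwise deleting the edge would preserve the components, and two forests with different
    numbers of edges would have equally many components. *)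
Lemma forest_edge F u v : forest F -> [set u; v] \in F ->
  ~~ conn (F :\ [set u; v]) u v.
Proof.
move=> fF uvF; apply/negP=> h; have := comps_add_conn h; rewrite setD1K // => e.
have /andP[lF /eqP c1] := fF; have /andP[_ /eqP c2] := forest_sub (subD1set F [set u; v]) fF.
move: c1; rewrite -c2 (cardsD1 [set u; v] F) uvF /ncomps -e add1n addSn => /eqP.
by rewrite eqn_leq ltnn.
Qed.

Lemma forestP F : reflect
  (loopless F /\ forall u v, [set u; v] \in F -> ~~ conn (F :\ [set u; v]) u v)
  (forest F).
Proof.
apply: (iffP idP) => [fF|[lF h]].
  by split=> [|u v]; [case/andP: fF|apply: forest_edge].
apply: (@edge_set_ind forest set0 F forest_set0 _ (sub0set F)) => E e _ eF eE EF fE.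
have [u [v [uv eE2]]] := looplessP lF eF; rewrite eE2 in eF eE *.
apply: forest_add => //; apply: contraNN (h _ _ eF); apply: conn_sub.
apply/subsetP=> f fE'; rewrite !inE (subsetP EF) // andbT.
by apply: contraNneq eE => <-.
Qed.

End EdgeSets.

(** * Counting the trees that contain a forest *)

Section Counting.
Variables (V : finType) (dg : V -> nat).
Implicit Types (F E T : {set {set V}}) (e C : {set V}) (u v w x y : V).

Definition dtree T := [&& forest T, ncomps T == 1 & [forall v, deg T v == dg v]].

Definition ext F := #|[set T | dtree T & F \subset T]|.

(** [res] and [resC] are the missing degrees r_v and R_C of the counting formula. *)
Definition res F v := dg v - deg F v.

Definition resC F C := \sum_(v in C) res F v.

Lemma res_deg0 F v : deg F v = 0 -> res F v = dg v.
Proof. by rewrite /res => ->; rewrite subn0. Qed.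

Lemma resC_set1 F v : resC F [set v] = res F v.
Proof. exact: big_set1. Qed.

Lemma ext_sum1 F : ext F = \sum_(T | dtree T && (F \subset T)) 1.
Proof. by rewrite /ext cardsE sum1_card. Qed.

Lemma deg_setU1 F e v : e \notin F -> deg (e |: F) v = (v \in e) + deg F v.
Proof.
move=> eF; rewrite /deg; case ve: (v \in e); last first.
  rewrite add0n; apply: eq_card => f; rewrite !inE.
  by case: eqP => //= ->; rewrite ve andbF.
rewrite (_ : [set f in e |: F | v \in f] = e |: [set f in F | v \in f]).
  by rewrite cardsU1 inE (negbTE eF).
by apply/setP=> f; rewrite !inE; case: eqP => //= ->; rewrite ve.
Qed.

Lemma deg_sub F E v : F \subset E -> deg F v <= deg E v.
Proof.
move=> /subsetP s; apply: subset_leq_card; apply/subsetP=> f.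
by rewrite !inE => /andP[/s-> ->].
Qed.

Lemma sum_deg F : loopless F -> \sum_v deg F v = 2 * #|F|.
Proof.
move=> /forall_inP lF; rewrite /deg.
under eq_bigr do rewrite -sum1_card.
rewrite (exchange_big_dep (mem F)) /= => [|v e _]; last by rewrite inE => /andP[].
rewrite mulnC -sum_nat_const; apply: eq_bigr => e eF.
rewrite -(eqP (lF e eF)) -sum1_card; apply: eq_bigl => v.
by rewrite inE eF.
Qed.

Lemma eq_set2 u v a b : u != v ->
  ([set u; v] == [set a; b]) = ((a, b) == (u, v)) || ((a, b) == (v, u)).
Proof.
move=> uv; rewrite !xpair_eqE; apply/eqP/idP; last first.
  by case/orP=> /andP[/eqP-> /eqP->] //; rewrite setUC.
move=> h; have : (a \in [set u; v]) && (b \in [set u; v]) by rewrite h !inE !eqxx orbT.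
have : (u \in [set a; b]) && (v \in [set a; b]) by rewrite -h !inE !eqxx orbT.
rewrite !inE !(eq_sym u) !(eq_sym v) => /andP[h1 h2] /andP[].
case/orP=> /eqP ea /orP[]/eqP eb; rewrite ea eb ?eqxx ?orbT //.
  by move: h2; rewrite ea eb orbb (negbTE uv).
by move: h1; rewrite ea eb orbb eq_sym (negbTE uv).
Qed.

Lemma sum_links F : loopless F ->
  \sum_(p : V * V) ([set p.1; p.2] \in F) = 2 * #|F|.
Proof.
move=> lF.
have -> : \sum_(p : V * V) ([set p.1; p.2] \in F) =
          \sum_(p : V * V) \sum_(e in F) (e == [set p.1; p.2]).
  apply: eq_bigr => p _; case: (boolP (_ \in F)) => pF.
    rewrite (bigD1 _ pF) /= eqxx big1 // => e /andP[_ /negbTE->] //.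
  by rewrite big1 // => e eF; case: eqP => // ee; rewrite -ee eF in pF.
rewrite exchange_big /= mulnC -sum_nat_const; apply: eq_bigr => e eF.
have [u [v [uv ->]]] := looplessP lF eF.
rewrite -big_mkcond /= sum1_card.
rewrite (_ : 2 = #|[set (u, v); (v, u)]|); last first.
  by rewrite cards2 xpair_eqE (negbTE uv).
apply: eq_card => -[a b].
by rewrite -[LHS]/([set u; v] == [set a; b]) eq_set2 // !inE.
Qed.

Lemma dtree_deg T v : dtree T -> deg T v = dg v.
Proof. by case/and3P=> _ _ /forallP/(_ v)/eqP. Qed.

Lemma dtree_forest T : dtree T -> forest T.
Proof. by case/and3P. Qed.

Lemma dtree_card T : dtree T -> #|T|.+1 = #|V|.
Proof. by case/and3P => /andP[_ /eqP<-] /eqP-> _; rewrite addn1. Qed.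

(** An edge of [T] outside [F] within one component of [F] would close a cycle in [T]. *)
Lemma forest_newlink F T u v : forest T -> F \subset T ->
  ([set u; v] \in T :\: F) = ([set u; v] \in T) && ~~ conn F u v.
Proof.
move=> fT FT; rewrite inE andbC; case uvT: (_ \in T) => //=.
apply/idP/idP => [uvF|]; last by apply: contra; exact: conn1.
apply: contra (forest_edge fT uvT); apply: conn_sub.
apply/subsetP=> f fF; rewrite !inE (subsetP FT) // andbT.
by apply: contraNneq uvF => <-.
Qed.

Lemma ext_sub F E : F \subset E -> ext E <= ext F.
Proof.
move=> FE; apply: subset_leq_card; apply/subsetP=> T; rewrite !inE.
by case/andP=> -> /(subset_trans FE)->.
Qed.

Lemma ext_gt0P F : reflect (exists2 T, dtree T & F \subset T) (0 < ext F).
Proof.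
apply: (iffP card_gt0P) => -[T].
  by rewrite inE => /andP[]; exists T.
by move=> h1 h2; exists T; rewrite inE h1.
Qed.

Lemma ext_gt0_deg F v : 0 < ext F -> deg F v <= dg v.
Proof. by case/ext_gt0P=> T h1 h2; rewrite -(dtree_deg v h1) deg_sub. Qed.

Lemma ext_gt0_forest F : 0 < ext F -> forest F.
Proof. by case/ext_gt0P=> T h1 h2; exact: forest_sub h2 (dtree_forest h1). Qed.

(** Counts pairs of a tree containing [F] and an oriented edge of it outside [F]. Each tree has
    [(ncomps F).-1] such edges, which by [forest_newlink] are its edges between different components
    of [F]. *)
Lemma ext_double_count F : forest F ->
  2 * (ncomps F).-1 * ext F =
  \sum_(p : V * V | ~~ conn F p.1 p.2) ext ([set p.1; p.2] |: F).
Proof.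
move=> fF.
have -> : \sum_(p : V * V | ~~ conn F p.1 p.2) ext ([set p.1; p.2] |: F) =
   \sum_(p : V * V | ~~ conn F p.1 p.2) \sum_(T | dtree T && (F \subset T)) ([set p.1; p.2] \in T).
  apply: eq_bigr => p _; rewrite /ext -sum1_card -big_mkcondr /=.
  apply: eq_bigl => T; rewrite !inE subUset sub1set.
  by rewrite (andbC (_ \in T)) andbA.
rewrite exchange_big /= mulnC /ext -sum_nat_const big_set /=.
apply: eq_bigr => T /andP[dT FT].
have fT := dtree_forest dT.
have lT : loopless (T :\: F).
  by case/andP: fT => lT _; apply: loopless_sub lT; exact: subsetDl.
have -> : (ncomps F).-1 = #|T :\: F|.
  have /andP[_ /eqP h1] := fF; have h2 := dtree_card dT.
  rewrite cardsD (setIidPr FT); lia.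
rewrite -sum_links // [in RHS]big_mkcond /=; apply: eq_bigr => p _.
by rewrite forest_newlink //; case: (conn _ _ _); rewrite ?andbF ?andbT.
Qed.

Lemma conn_edgeN F u v : ~~ conn F u v -> [set u; v] \notin F.
Proof. by apply: contra; exact: conn1. Qed.

Lemma res_add F u v w : ~~ conn F u v ->
  res ([set u; v] |: F) w = res F w - (w \in [set u; v]).
Proof. by move=> /conn_edgeN uv; rewrite /res deg_setU1 // addnC subnDA. Qed.

Lemma resC_add_disj F u v C : ~~ conn F u v -> u \notin C -> v \notin C ->
  resC ([set u; v] |: F) C = resC F C.
Proof.
move=> uv uC vC; apply: eq_bigr => w wC; rewrite res_add // !inE.
have /negbTE-> : w != u by apply: contraNneq uC => <-.
have /negbTE-> : w != v by apply: contraNneq vC => <-.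
by rewrite subn0.
Qed.

Lemma cmp_conn F u v w : w \in cmp F u -> w \in cmp F v -> conn F u v.
Proof.
by rewrite !inE => uw vw; apply: conn_trans uw _; rewrite conn_sym.
Qed.

Lemma resC_cmp F u : resC F (cmp F u) = res F u + \sum_(w in cmp F u | w != u) res F w.
Proof. by rewrite /resC (bigD1 u) ?mem_cmp. Qed.

Lemma resC_add_cmp F u v : ~~ conn F u v -> 0 < res F u -> 0 < res F v ->
  resC ([set u; v] |: F) (cmp F u :|: cmp F v) =
  (resC F (cmp F u)).-1 + (resC F (cmp F v)).-1.
Proof.
move=> uv ru rv; rewrite {1}/resC (eq_bigl (mem [predU cmp F u & cmp F v])) => [|w].
  2: by rewrite in_setU.
rewrite bigU /=; last first.
  rewrite -setI_eq0; apply/eqP/setP=> w; rewrite [RHS]inE.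
  by apply/negP; rewrite in_setI => /andP[/cmp_conn h /h]; apply/negP.
have neq w : conn F u w -> (w == v) = false.
  by move=> uw; apply: contraNF uv => /eqP<-.
have neq' w : conn F v w -> (w == u) = false.
  by move=> vw; apply: contraNF uv => /eqP<-; rewrite conn_sym.
congr addn; rewrite resC_cmp.
  rewrite (bigD1 u) ?mem_cmp //= res_add // !inE eqxx /=.
  rewrite (eq_bigr (res F)) => [|w]; first by lia.
  rewrite !inE => /andP[uw /negbTE wu]; rewrite res_add // !inE wu neq //.
  by rewrite subn0.
rewrite (bigD1 v) ?mem_cmp //= res_add // !inE eqxx orbT.
rewrite (eq_bigr (res F)) => [|w]; first by lia.
rewrite !inE => /andP[uw /negbTE wu]; rewrite res_add // !inE wu neq' //.
by rewrite subn0.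
Qed.

Lemma ext_eq0 F u v : ~~ conn F u v -> res F u * res F v = 0 ->
  ext ([set u; v] |: F) = 0.
Proof.
move=> uv r0; apply/eqP; rewrite -leqn0 leqNgt; apply/negP=> e0.
have h w : w \in [set u; v] -> 0 < res F w.
  move=> wuv; have := ext_gt0_deg w e0; rewrite deg_setU1 ?conn_edgeN //.
  by rewrite wuv add1n subn_gt0.
have hu := h u (set21 _ _). have hv := h v (set22 _ _).
by move/eqP: r0; rewrite muln_eq0; lia.
Qed.

Hypothesis sum_dg : \sum_v dg v = 2 * #|V|.-1.

(** Handshake lemma for the missing edges: a tree needs [(ncomps F).-1] edges more than [F]. *)
Lemma sum_resC F : forest F -> (forall v, deg F v <= dg v) ->
  \sum_(C in comps F) resC F C = 2 * (ncomps F).-1.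
Proof.
move=> fF dF; have /andP[lF /eqP hF] := fF.
rewrite /resC -(comps_big _ F (fun _ => res F)) /res.
have := sum_dg; rewrite (eq_bigr (fun v => res F v + deg F v)).
  rewrite big_split /= sum_deg // -hF => h; move: h; rewrite /res.
  have : 0 < #|V| -> 0 < ncomps F.
    by case/card_gt0P=> v _; apply/card_gt0P; exists (cmp F v); exact: cmp_in.
  by rewrite -hF; lia.
by move=> v _; rewrite /res subnK.
Qed.

(** With one component nothing is missing: [F] is itself the only tree, while the product would
    vanish and c - 2 would be truncated. Hence the separate case. *)
Definition ext_val F := if ncomps F == 1 then 1
  else (ncomps F - 2)`! * \prod_(C in comps F) resC F C.

Lemma sum_offdiag (I : finType) (A : {set I}) (f : I -> nat) :
  \sum_(i in A) \sum_(j in A | j != i) (f i + f j) = 2 * #|A|.-1 * \sum_(i in A) f i.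
Proof.
have cA i : i \in A -> \sum_(j in A | j != i) f i = #|A|.-1 * f i.
  move=> iA; rewrite sum_nat_const (cardsD1 i A) iA /=; congr (_ * _).
  by apply: eq_card => j; rewrite !inE andbC.
under eq_bigr do rewrite big_split.
rewrite big_split /= (eq_bigr (fun i => #|A|.-1 * f i)) //.
rewrite (exchange_big_dep (mem A)) /= => [|i j _ /andP[]//].
have -> : \sum_(j in A) \sum_(i in A | (j \in A) && (j != i)) f j = \sum_(j in A) #|A|.-1 * f j.
  apply: eq_bigr => j jA; rewrite -cA //; apply: eq_bigl => i.
  by rewrite jA /= eq_sym.
by rewrite -big_distrr /= -mulnA mul2n addnn.
Qed.

(** Groups the possible new edges by the two components they join; summing r_v over a component
    gives R_C. *)
Lemma sum_pairs_comps F (g : {set V} -> {set V} -> nat) :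
  \sum_(p : V * V | ~~ conn F p.1 p.2) res F p.1 * res F p.2 * g (cmp F p.1) (cmp F p.2) =
  \sum_(C in comps F) \sum_(C' in comps F | C' != C) resC F C * resC F C' * g C C'.
Proof.
rewrite -(pair_big_dep xpredT (fun u v => ~~ conn F u v)
  (fun u v => res F u * res F v * g (cmp F u) (cmp F v))) /=.
pose G C u := \sum_(C' in comps F | C' != C) res F u * resC F C' * g C C'.
transitivity (\sum_u G (cmp F u) u).
  apply: eq_bigr => u _; rewrite /G.
  under eq_bigl do rewrite -cmp_eq eq_sym.
  rewrite big_mkcondr /= big_mkcond /=.
  rewrite (comps_big _ F (fun C v => if C != cmp F u then
    res F u * res F v * g (cmp F u) C else 0)).
  apply: eq_bigr => C CF; case: ifP => _; last by rewrite big1.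
  by rewrite /resC big_distrr /= big_distrl /=.
rewrite (comps_big _ F G); apply: eq_bigr => C CF; rewrite /G exchange_big /=.
by apply: eq_bigr => C' _; rewrite /resC !big_distrl.
Qed.

Lemma prod_comps_add F u v : ~~ conn F u v -> 0 < res F u -> 0 < res F v ->
  \prod_(C in comps ([set u; v] |: F)) resC ([set u; v] |: F) C =
  ((resC F (cmp F u)).-1 + (resC F (cmp F v)).-1) *
  \prod_(C in comps F :\ cmp F u :\ cmp F v) resC F C.
Proof.
move=> uv ru rv; rewrite comps_add // big_setU1 ?cmp_addN //= resC_add_cmp //.
congr (_ * _); apply: eq_bigr => C; rewrite !inE => /and3P[Cv Cu CF].
by apply: resC_add_disj; rewrite ?(mem_comps _ CF).
Qed.

Lemma prod_comps_off F (C C' : {set V}) : C \in comps F -> C' \in comps F -> C' != C ->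
  \prod_(D in comps F) resC F D =
  resC F C * resC F C' * \prod_(D in comps F :\ C :\ C') resC F D.
Proof.
move=> CF CF' CC'; rewrite (big_setD1 C) //= (big_setD1 C') ?mulnA //.
by rewrite !inE CC'.
Qed.

Lemma sum_predC F : forest F -> (forall v, deg F v <= dg v) ->
  (forall C, C \in comps F -> 0 < resC F C) -> 1 < ncomps F ->
  \sum_(C in comps F) (resC F C).-1 = ncomps F - 2.
Proof.
move=> fF dF R0 c1.
have := sum_resC fF dF; rewrite (eq_bigr (fun C => (resC F C).-1 + 1)) => [|C CF].
  by rewrite big_split /= sum1_card -/(ncomps F); lia.
by have := R0 C CF; lia.
Qed.

(** The conjectured value satisfies the recursion of [ext_double_count], up to the factors r_u r_v
    that come from the factorials of missing degrees. *)
Lemma sum_ext_val F : forest F -> (forall v, deg F v <= dg v) -> 1 < ncomps F ->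
  \sum_(p : V * V | ~~ conn F p.1 p.2)
     res F p.1 * res F p.2 * ext_val ([set p.1; p.2] |: F) =
  2 * (ncomps F).-1 * ext_val F.
Proof.
move=> fF dF c1; have SR := sum_resC fF dF.
have cadd p : ~~ conn F p.1 p.2 -> ncomps ([set p.1; p.2] |: F) = (ncomps F).-1.
  by move=> /ncomps_add->.
(* With two components every new edge leads to the special value 1 of [ext_val], so this case is
   computed by hand. *)
have [c2|c3] : ncomps F = 2 \/ 2 < ncomps F by lia.
  rewrite /ext_val c2 /= mul1n.
  transitivity (\sum_(p : V * V | ~~ conn F p.1 p.2) res F p.1 * res F p.2 * 1).
    by apply: eq_bigr => p /cadd; rewrite c2 => ->.
  rewrite (sum_pairs_comps F (fun _ _ => 1)).
  have /eqP/cards2P[A [B [AB hF]]] := c2.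
  rewrite hF !big_setU1 ?inE //= !big_set1.
  have e1 : \sum_(C' in [set A; B] | C' != A) resC F A * resC F C' * 1 = resC F A * resC F B.
    rewrite (bigD1 B) /= ?inE ?eqxx ?orbT ?(eq_sym B) // muln1 big1 ?addn0 // => C.
    by rewrite !inE => /andP[/andP[/orP[]/eqP-> //]]; rewrite ?eqxx ?andbF.
  have e2 : \sum_(C' in [set A; B] | C' != B) resC F B * resC F C' * 1 = resC F A * resC F B.
    rewrite (bigD1 A) /= ?inE ?eqxx // muln1 mulnC big1 ?addn0 // => C.
    by rewrite !inE => /andP[/andP[/orP[]/eqP-> //]]; rewrite ?eqxx ?andbF.
  by rewrite e1 e2 /=; lia.
transitivity (\sum_(p : V * V | ~~ conn F p.1 p.2) res F p.1 * res F p.2 *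
   ((ncomps F - 3)`! * (((resC F (cmp F p.1)).-1 + (resC F (cmp F p.2)).-1) *
     \prod_(C in comps F :\ cmp F p.1 :\ cmp F p.2) resC F C))).
  apply: eq_bigr => p uv; have [r0|] := posnP (res F p.1 * res F p.2); first by rewrite r0.
  rewrite muln_gt0 => /andP[r1 r2]; congr (_ * _).
  rewrite /ext_val cadd // ifN ?prod_comps_add //; last by lia.
  by congr ((_)`! * _); lia.
rewrite (sum_pairs_comps F (fun C C' => (ncomps F - 3)`! * (((resC F C).-1 + (resC F C').-1) *
     \prod_(D in comps F :\ C :\ C') resC F D))).
rewrite /ext_val ifN; last by lia.
set Pi := \prod_(C in comps F) _.
transitivity ((ncomps F - 3)`! * Pi *
    \sum_(C in comps F) \sum_(C' in comps F | C' != C) ((resC F C).-1 + (resC F C').-1)).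
  rewrite big_distrr /=; apply: eq_bigr => C CF; rewrite big_distrr /=.
  apply: eq_bigr => C' /andP[CF' CC']; rewrite /Pi (prod_comps_off CF CF' CC'); ring.
rewrite sum_offdiag -/(ncomps F).
(* If a component has no missing degree, both sides vanish. Otherwise the R_C - 1 add up to c - 2,
   which turns (c - 3)! into (c - 2)!. *)
have [Pi0|Pi0] := posnP Pi; first by rewrite Pi0 !(mul0n, muln0).
rewrite sum_predC //; last first.
  by move=> C CF; move: Pi0; rewrite /Pi (bigD1 C) //= muln_gt0 => /andP[].
have -> : ncomps F - 2 = (ncomps F - 3).+1 by lia.
rewrite factS; ring.
Qed.

Lemma ext_ncomps1 F : forest F -> (forall v, deg F v <= dg v) -> ncomps F = 1 ->
  ext F * \prod_v (res F v)`! = 1.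
Proof.
move=> fF dF c1; have := sum_resC fF dF; rewrite c1 /= muln0 /resC.
rewrite -(comps_big _ F (fun _ => res F)) => /eqP; rewrite sum_nat_eq0 => /forallP r0'.
have r0 v : res F v = 0 by exact/eqP/(implyP (r0' v)).
rewrite big1 ?muln1 => [|v _]; last by rewrite r0.
have dtF : dtree F.
  rewrite /dtree fF c1 /=; apply/forallP=> v; rewrite eqn_leq dF.
  by rewrite -subn_eq0 -/(res F v) r0.
rewrite /ext (_ : [set T | _ & _] = [set F]) ?cards1 //.
apply/setP=> T; rewrite !inE; apply/andP/eqP=> [[dT FT]|->] //.
apply/esym/eqP; rewrite eqEcard FT; have := dtree_card dT; have := dtree_card dtF.
by lia.
Qed.

(* Double counting the pairs (tree, edge outside the forest) yields a recursion
   on the number of components. *)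
Theorem ext_formula F : forest F -> (forall v, deg F v <= dg v) -> 0 < #|V| ->
  ext F * \prod_v (res F v)`! = ext_val F.
Proof.
move=> fF dF V0; have [m cm] := ubnP (ncomps F); elim: m F cm fF dF => // m IHm F cm fF dF.
have c0 : 0 < ncomps F.
  by case/card_gt0P: V0 => v _; apply/card_gt0P; exists (cmp F v); exact: cmp_in.
have [c1|c1] := eqVneq (ncomps F) 1.
  by rewrite ext_ncomps1 // /ext_val c1.
have c2 : 1 < ncomps F by lia.
apply/eqP; rewrite -(@eqn_pmul2l (2 * (ncomps F).-1)); last by lia.
rewrite -sum_ext_val // mulnA ext_double_count // big_distrl /=; apply/eqP.
apply: eq_bigr => -[u v] /= uv.
have [r0|] := posnP (res F u * res F v); first by rewrite ext_eq0 // r0.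
rewrite muln_gt0 => /andP[ru rv].
have uv' : u != v by apply: contraNneq uv => ->; rewrite conn0.
have dE w : deg ([set u; v] |: F) w <= dg w.
  rewrite deg_setU1 ?conn_edgeN // !inE; have := dF w; move: ru rv; rewrite /res.
  by case: eqP => [->|_]; case: eqP => [->|_] /=; lia.
have cE : ncomps ([set u; v] |: F) < m by have := ncomps_add uv; lia.
rewrite -(IHm _ cE (forest_add fF uv) dE).
rewrite mulnCA; congr (_ * _).
rewrite (bigD1 u) //= (bigD1 v) 1?eq_sym //= [in RHS](bigD1 u) //= [in RHS](bigD1 v) 1?eq_sym //=.
rewrite !res_add // !inE !eqxx orbT /=.
rewrite (eq_bigr (fun w => (res ([set u; v] |: F) w)`!)) => [|w /andP[wu wv]].
  have -> : res F u = (res F u - 1).+1 by lia.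
  have -> : res F v = (res F v - 1).+1 by lia.
  by rewrite !factS !subSS !subn0; ring.
by rewrite res_add // !inE (negbTE wu) (negbTE wv) subn0.
Qed.

(** The counting formula contains the factor R_C, which therefore cannot vanish. *)
Lemma ext_gt0_resC F C : 0 < ext F -> 1 < ncomps F -> C \in comps F -> 0 < resC F C.
Proof.
move=> e0 c1 CF.
have V0 : 0 < #|V| by case/imsetP: CF => v _ _; apply/card_gt0P; exists v.
have dF v := ext_gt0_deg v e0.
have : 0 < ext F * \prod_v (res F v)`!.
  by rewrite muln_gt0 e0 prodn_gt0 // => v; exact: fact_gt0.
rewrite ext_formula ?(ext_gt0_forest e0) // /ext_val ifN; last by lia.
by rewrite muln_gt0 (bigD1 C) //= muln_gt0 => /and3P[].
Qed.

(** The quotient of the counting formulas for the two forests, cleared of denominators. *)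
Lemma ext_step F u v : 0 < ext F -> 2 < ncomps F -> ~~ conn F u v ->
  ext ([set u; v] |: F) * (ncomps F - 2) * (resC F (cmp F u) * resC F (cmp F v)) =
  ext F * (res F u * res F v) * ((resC F (cmp F u)).-1 + (resC F (cmp F v)).-1).
Proof.
move=> e0 c3 uv; have fF := ext_gt0_forest e0; have dF w := ext_gt0_deg w e0.
have [r0|] := posnP (res F u * res F v); first by rewrite ext_eq0 // r0 muln0 !mul0n.
rewrite muln_gt0 => /andP[ru rv].
have uv' : u != v by apply: contraNneq uv => ->; rewrite conn0.
have V0 : 0 < #|V| by apply/card_gt0P; exists u.
have cE := ncomps_add uv.
set E := _ |: F in cE *.
have P0 : 0 < \prod_w (res E w)`! by rewrite prodn_gt0 // => w; exact: fact_gt0.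
have hE : ext E * \prod_w (res E w)`! = ext_val E.
  apply: ext_formula => //; first exact: forest_add.
  move=> w; rewrite deg_setU1 ?conn_edgeN // !inE.
  have := dF w; move: ru rv; rewrite /res.
  by case: eqP => [->|_]; case: eqP => [->|_] /=; lia.
have hF := ext_formula fF dF V0.
apply/eqP; rewrite -(eqn_pmul2r P0); apply/eqP.
(* The new edge lowers the missing degrees of [u] and [v] by one, which is where r_u r_v comes
   from. *)
have PF : \prod_w (res F w)`! = res F u * res F v * \prod_w (res E w)`!.
  rewrite (bigD1 u) //= (bigD1 v) 1?eq_sym //= [in RHS](bigD1 u) //= [in RHS](bigD1 v) 1?eq_sym //=.
  rewrite !res_add // !inE !eqxx orbT /=.
  rewrite (eq_bigr (fun w => (res E w)`!)) => [|w /andP[wu wv]].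
    have -> : res F u = (res F u - 1).+1 by lia.
    have -> : res F v = (res F v - 1).+1 by lia.
    by rewrite !factS !subSS !subn0; ring.
  by rewrite res_add // !inE (negbTE wu) (negbTE wv) subn0.
transitivity (ext F * (\prod_w (res F w)`!) *
    ((resC F (cmp F u)).-1 + (resC F (cmp F v)).-1)); last by rewrite PF; ring.
rewrite hF.
transitivity (ext_val E * (ncomps F - 2) * (resC F (cmp F u) * resC F (cmp F v))).
  by rewrite -hE; ring.
rewrite /ext_val !ifN; try lia.
rewrite prod_comps_add // (@prod_comps_off F (cmp F u) (cmp F v)) ?cmp_in //; last first.
  by rewrite eq_sym cmp_eq.
have -> : ncomps F - 2 = (ncomps E - 2).+1 by lia.
rewrite factS; ring.
Qed.

End Counting.

(** * Adding a path to a forest *)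

Section Paths.
Variables (V : finType) (dg : V -> nat).
Hypothesis sum_dg : \sum_v dg v = 2 * #|V|.-1.
Implicit Types (F E T : {set {set V}}) (e C : {set V}) (u v w x y : V) (s : seq (V * V)).

Local Notation ext := (ext dg).
Local Notation res := (res dg).
Local Notation resC := (resC dg).

(* The analogue of sigma^2 for trees contracted along F. *)
Definition exc F := \sum_(C in comps F) (resC F C).-1 * (resC F C).-2.

(* With s = [(v1,u1), ..., (vn,un)], adds the edges x v1, u1 v2, ..., un y; for
   a valid s, the pair (vi,ui) consists of the points of entry and of exit of
   the i-th component of F that the path crosses. *)
Fixpoint padd F x s y : {set {set V}} :=
  if s is vu :: s' then padd ([set x; vu.1] |: F) vu.2 s' y
  else [set x; y] |: F.

Definition pvalid F x s y := all (fun vu => conn F vu.1 vu.2) s &&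
  uniq (cmp F x :: rcons [seq cmp F vu.1 | vu <- s] (cmp F y)).

(** Counts the choices of a missing half-edge for entering and one for leaving each crossed
    component; one choice is lost when both are at the same vertex. *)
Definition pweight F s := \prod_(vu <- s) (res F vu.1 * (res F vu.2 - (vu.1 == vu.2))).

(** Crossing a component uses up two of its missing half-edges; the others pass to the merged
    component. *)
Definition pexcess F s := \sum_(vu <- s) (resC F (cmp F vu.1)).-2.

Lemma padd_sub F x s y : F \subset padd F x s y.
Proof.
elim: s F x => [|vu s IH] F x /=; first exact: subsetUr.
by apply: subset_trans (IH _ _); exact: subsetUr.
Qed.

Lemma ext_gt0_res F u v : ~~ conn F u v -> 0 < ext ([set u; v] |: F) ->
  0 < res F u /\ 0 < res F v.
Proof.
move=> uv e0; apply/andP; rewrite -muln_gt0 lt0n; apply: contraTneq e0 => r0.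
by rewrite ext_eq0.
Qed.

(** One merged term replaces those of [u] and [v]. The term of [v] is dropped; that of [u] stays on
    the left so that the inequalities telescope along a path. *)
Lemma exc_step F u v : ~~ conn F u v -> 0 < ext ([set u; v] |: F) ->
  exc ([set u; v] |: F) + (resC F (cmp F u)).-1 * (resC F (cmp F u)).-2 <=
  exc F + ((resC F (cmp F u)).-1 + (resC F (cmp F v)).-1).-1 *
          ((resC F (cmp F u)).-1 + (resC F (cmp F v)).-1).-2.
Proof.
move=> uv e0; have [ru rv] := ext_gt0_res uv e0.
rewrite /exc comps_add // big_setU1 ?cmp_addN //= resC_add_cmp //.
rewrite [X in _ <= X + _](big_setD1 (cmp F u)) ?cmp_in //=.
rewrite [X in _ <= _ + X + _](big_setD1 (cmp F v)) /=; last first.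
  by rewrite !inE cmp_in eq_sym cmp_eq uv.
rewrite [X in _ + X + _ <= _](eq_bigr (fun C => (resC F C).-1 * (resC F C).-2)); first last.
  by move=> C; rewrite !inE => /and3P[Cv Cu CF]; rewrite resC_add_disj ?(mem_comps _ CF).
have aux (A B S D : nat) : A + S + B <= B + (D + S) + A by lia.
exact: aux.
Qed.

Lemma cmp_add_other F x v w : ~~ conn F w x -> ~~ conn F w v ->
  cmp ([set x; v] |: F) w = cmp F w.
Proof. by move=> /negbTE wx /negbTE wv; rewrite cmp_add wx wv. Qed.

Lemma resC_add_other F x v w : ~~ conn F x v -> ~~ conn F w x -> ~~ conn F w v ->
  resC ([set x; v] |: F) (cmp ([set x; v] |: F) w) = resC F (cmp F w).
Proof.
by move=> xv wx wv; rewrite cmp_add_other // resC_add_disj // inE.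
Qed.

(** After the first edge the rest of the path, restarted at [u], is valid for the enlarged forest,
    and its later crossing points lie outside the merged component. *)
Lemma pvalid_cons F x v u s y : pvalid F x ((v, u) :: s) y ->
  [/\ ~~ conn F x v, conn F v u,
      (forall w, w \in y :: map fst s -> ~~ conn F w x /\ ~~ conn F w v),
      (forall w, w \in map snd s -> ~~ conn F w x /\ ~~ conn F w v) &
      pvalid ([set x; v] |: F) u s y].
Proof.
rewrite /pvalid /= => /andP[/andP[vu cs]].
rewrite inE negb_or cmp_eq -!andbA => /and4P[xv xs vs us].
have h w : w \in y :: map fst s -> ~~ conn F w x /\ ~~ conn F w v.
  move=> ws; have wsC : cmp F w \in rcons [seq cmp F vu.1 | vu <- s] (cmp F y).
    rewrite mem_rcons inE; move: ws; rewrite inE => /orP[/eqP->|]; first by rewrite eqxx.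
    by move=> /mapP[p ps ->]; rewrite (map_f (fun vu => cmp F vu.1)) ?orbT.
  by split; rewrite -cmp_eq; [apply: contraNneq xs | apply: contraNneq vs] => <-.
have h2 w : w \in map snd s -> ~~ conn F w x /\ ~~ conn F w v.
  case/mapP=> p ps ->; have := h p.1; rewrite inE map_f ?orbT //.
  case=> // h3 h4.
  have := allP cs p ps => /= c; rewrite conn_sym in c.
  by split; [apply: contra h3|apply: contra h4] => k; apply: conn_trans k; rewrite conn_sym.
split=> //.
have hcmp p : p \in s -> cmp ([set x; v] |: F) p.1 = cmp F p.1.
  by move=> ps; have [] := h p.1; rewrite ?inE ?map_f ?orbT //; exact: cmp_add_other.
have hcy : cmp ([set x; v] |: F) y = cmp F y.
  by have [] := h y; rewrite ?inE ?eqxx //; exact: cmp_add_other.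
have -> : [seq cmp ([set x; v] |: F) vu.1 | vu <- s] = [seq cmp F vu.1 | vu <- s].
  by apply/eq_in_map => p; exact: hcmp.
rewrite hcy us !andbT; apply/andP; split.
  apply/allP=> p ps /=; apply: conn_sub (allP cs p ps); exact: subsetUr.
rewrite mem_rcons inE negb_or; have ux : u \notin cmp F y.
  rewrite inE; have [_] := h y (mem_head _ _); apply: contra => yu.
  by apply: conn_trans yu _; rewrite conn_sym.
apply/andP; split; first by apply: contraNneq ux => <-; exact: mem_cmp.
apply/negP; case/mapP=> p ps hp.
have hp1 : p.1 \in y :: map fst s by rewrite inE map_f ?orbT.
have [_] := h _ hp1; apply/negP/negPn.
have : u \in cmp F p.1 by rewrite -hp; exact: mem_cmp.
by rewrite inE => pu; apply: conn_trans pu _; rewrite conn_sym.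
Qed.

(** Iterates [ext_step] and [exc_step]. The missing degree of the growing component of [x] is a
    numerator in one step and a denominator in the next, so it cancels; the factors c - 2, c - 3,
    ... form the falling factorial. *)
Lemma path_step F x s y : 0 < ext (padd F x s y) -> (size s).+2 < ncomps F ->
  pvalid F x s y ->
  [/\ ncomps F = ncomps (padd F x s y) + (size s).+1,
      ext (padd F x s y) * (ncomps F - 2) ^_ (size s).+1 *
        (resC F (cmp F x) * (\prod_(vu <- s) resC F (cmp F vu.1)) * resC F (cmp F y)) =
      ext F * (res F x * pweight F s * res F y) *
        ((resC F (cmp F x)).-1 + (resC F (cmp F y)).-1 + pexcess F s) &
      exc (padd F x s y) + (resC F (cmp F x)).-1 * (resC F (cmp F x)).-2 <=
      exc F + ((resC F (cmp F x)).-1 + (resC F (cmp F y)).-1 + pexcess F s).-1 *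
              ((resC F (cmp F x)).-1 + (resC F (cmp F y)).-1 + pexcess F s).-2].
Proof.
rewrite /pweight /pexcess.
elim: s F x => [|[v u] s IH] F x e0 cF vs.
  move: vs; rewrite /pvalid /= inE cmp_eq andbT => xy.
  have eF : 0 < ext F by exact: leq_trans e0 (ext_sub dg (subsetUr _ _)).
  rewrite !big_nil !muln1 addn0; split.
  - by rewrite (ncomps_add xy) addn1.
  - by rewrite ffactn1 ext_step.
  - exact: exc_step.
rewrite /= in e0 cF *; case/pvalid_cons: vs => xv vu h1 h2 vs.
set F1 := _ |: F in e0 vs *.
have e1 : 0 < ext F1 by exact: leq_trans e0 (ext_sub dg (padd_sub _ _ _ _)).
have eF : 0 < ext F by apply: leq_trans e1 (ext_sub dg (subsetUr _ _)).
have c1 := ncomps_add xv; rewrite -/F1 in c1.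
have [|i1 i2 i3] := IH F1 u e0 _ vs; first by lia.
have [rx rv] := ext_gt0_res xv e1.
have ux : u != x by apply: contraNneq xv => <-; rewrite conn_sym.
have cu1 : cmp F1 u = cmp F x :|: cmp F v by rewrite cmp_add (conn_sym F u v) vu orbT.
have Ru1 : resC F1 (cmp F1 u) = (resC F (cmp F x)).-1 + (resC F (cmp F v)).-1.
  by rewrite cu1 resC_add_cmp.
have ru1 : res F1 u = res F u - (v == u).
  by rewrite res_add // !inE (negbTE ux) eq_sym.
have hy : resC F1 (cmp F1 y) = resC F (cmp F y).
  by have [] := h1 y (mem_head _ _); exact: resC_add_other.
have ry : res F1 y = res F y.
  have [yx yv] := h1 y (mem_head _ _); rewrite res_add // !inE.
  have /negbTE-> : y != x by apply: contraNneq yx => ->; exact: conn0.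
  have /negbTE-> : y != v by apply: contraNneq yv => ->; exact: conn0.
  by rewrite subn0.
have hC p : p \in s -> resC F1 (cmp F1 p.1) = resC F (cmp F p.1).
  by move=> ps; have [] := h1 p.1; rewrite ?inE ?map_f ?orbT //; exact: resC_add_other.
have hC2 p : p \in s -> (resC F1 (cmp F1 p.1)).-2 = (resC F (cmp F p.1)).-2.
  by move=> /hC->.
have hr p : p \in s -> res F1 p.1 * (res F1 p.2 - (p.1 == p.2)) =
    res F p.1 * (res F p.2 - (p.1 == p.2)).
  move=> ps.
  have rF1 w : ~~ conn F w x -> ~~ conn F w v -> res F1 w = res F w.
    move=> wx wv; rewrite res_add // !inE.
    have /negbTE-> : w != x by apply: contraNneq wx => ->; exact: conn0.
    have /negbTE-> : w != v by apply: contraNneq wv => ->; exact: conn0.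
    by rewrite subn0.
  have [] := h1 p.1; rewrite ?inE ?map_f ?orbT // => k1 k2.
  have [] := h2 p.2; rewrite ?map_f // => k3 k4.
  by rewrite !rF1.
move: i2 i3; rewrite Ru1 hy ru1 ry.
rewrite (eq_big_seq _ hC) (eq_big_seq _ hr) (eq_big_seq _ hC2).
move=> i2 i3; rewrite !big_cons /=.
set S := \sum_(_ <- s) _ in i2 i3 *; set P := \prod_(_ <- s) resC _ _ in i2 *.
set W := \prod_(_ <- s) (_ * _) in i2 *.
have st := ext_step sum_dg eF _ xv; rewrite -/F1 in st; have {}st := st ltac:(lia).
have ex := exc_step xv e1; rewrite -/F1 in ex.
have Rx0 : 0 < resC F (cmp F x) by rewrite (ext_gt0_resC sum_dg) ?cmp_in //; lia.
have Rv0 : 0 < resC F (cmp F v) by rewrite (ext_gt0_resC sum_dg) ?cmp_in //; lia.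
have R1 : 0 < (resC F (cmp F x)).-1 + (resC F (cmp F v)).-1.
  by rewrite -Ru1 (ext_gt0_resC sum_dg) ?cmp_in //; lia.
have Ry0 : 0 < resC F (cmp F y) by rewrite (ext_gt0_resC sum_dg) ?cmp_in //; lia.
have P0 : 0 < P.
  rewrite /P big_seq prodn_cond_gt0 // => p ps.
  by rewrite (ext_gt0_resC sum_dg) ?cmp_in //; lia.
(* The path enters and leaves the component of [v], so two half-edges are missing there and the
   truncated [.-2] is exact. *)
have Rv2 : 1 < resC F (cmp F v).
  have : 0 < res F u - (v == u).
    rewrite lt0n; apply/eqP=> r0; have := i2; rewrite r0 !(mul0n, muln0).
    by apply/eqP; rewrite -lt0n !muln_gt0 e0 R1 P0 Ry0 ffact_gt0; lia.
  rewrite resC_cmp; case: eqP => [<-|/eqP nvu]; first by lia.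
  rewrite (bigD1 u) /= ?inE ?vu 1?eq_sym // subn0; lia.
have eqD : ((resC F (cmp F x)).-1 + (resC F (cmp F v)).-1).-1 + (resC F (cmp F y)).-1 + S =
   (resC F (cmp F x)).-1 + (resC F (cmp F y)).-1 + ((resC F (cmp F v)).-2 + S) by lia.
rewrite eqD in i2 i3.
split; first by lia.
  apply/eqP; rewrite -(eqn_pmul2r R1); apply/eqP.
  have -> : ncomps F - 2 = (ncomps F1 - 2).+1 by lia.
  rewrite [X in _ * X * _ * _ = _]ffactnS /=.
  transitivity (ext (padd F1 u s y) * (ncomps F1 - 2) ^_ (size s).+1 *
     (((resC F (cmp F x)).-1 + (resC F (cmp F v)).-1) * P * resC F (cmp F y)) *
     (ncomps F - 2) * (resC F (cmp F x) * resC F (cmp F v))).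
    have -> : ncomps F - 2 = (ncomps F1 - 2).+1 by lia.
    ring.
  rewrite i2.
  transitivity ((ext F1 * (ncomps F - 2) * (resC F (cmp F x) * resC F (cmp F v))) *
    ((res F u - (v == u)) * W * res F y *
     ((resC F (cmp F x)).-1 + (resC F (cmp F y)).-1 + ((resC F (cmp F v)).-2 + S)))).
    by ring.
  by rewrite st; ring.
have aux (a b c d f g : nat) : a + b <= c + d -> c + f <= g + b -> a + f <= g + d by lia.
exact: aux i3 ex.
Qed.

End Paths.

(** * Tree paths as paths through the components of a forest *)

Section PathCover.
Variable V : finType.
Implicit Types (F E T : {set {set V}}) (e C : {set V}) (u v w x y : V) (s : seq (V * V)).

Lemma padd_setU1 F e x s y : padd (e |: F) x s y = e |: padd F x s y.
Proof.
elim: s F x => [|vu s IH] F x /=; first by rewrite setUCA.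
by rewrite setUCA IH.
Qed.

Lemma padd_cat F x s v u s' y : padd F u s' y \subset padd F x (s ++ (v, u) :: s') y.
Proof.
elim: s F x => [|vu s IH] F x /=; first by rewrite padd_setU1; exact: subsetUr.
by apply: subset_trans (IH _ _) _; rewrite padd_setU1; exact: subsetUr.
Qed.

(* Loop erasure of the sequence of components of F visited by the path. *)
Lemma path_cover F T x p y : F \subset T -> path (lnk T) x p -> y = last x p ->
    (forall w, conn F w y -> w = y) -> x != y ->
  exists u s, [/\ conn F x u, pvalid F u s y, padd F u s y \subset T, size s < size p &
    forall vu, vu \in (x, u) :: s -> (vu.1 \in x :: p) && (vu.2 \in x :: p)].
Proof.
move=> FT; elim: p x => [|w p IH] x /=; first by move=> _ ->; rewrite eqxx.
case/andP=> xw pw yE yiso xy.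
have xyC : ~~ conn F x y by apply: contraNN xy => /yiso->.
have [wy|wy] := eqVneq w y.
  exists x, [::]; rewrite conn0 /pvalid /= inE cmp_eq andbT; split=> //.
    by rewrite subUset sub1set FT andbT -wy.
  by move=> vu; rewrite mem_seq1 => /eqP->; rewrite /= mem_head.
have [u [s [wu vs sT ss ps]]] := IH w pw yE yiso wy.
have ps' vu : vu \in (w, u) :: s -> (vu.1 \in [:: x, w & p]) && (vu.2 \in [:: x, w & p]).
  by move=> /ps /andP[h1 h2]; rewrite inE h1 inE h2 !orbT.
have up : u \in [:: x, w & p] by have /andP[] := ps' _ (mem_head _ _).
have [xwC|xwC] := boolP (conn F x w).
  exists u, s; split=> //; last 1 first.
  - move=> vu; rewrite inE => /orP[/eqP->|vus]; first by rewrite /= up mem_head.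
    by apply: ps'; rewrite inE vus orbT.
  - exact: conn_trans xwC wu.
  - exact: ltnW.
(* If the rest of the path comes back to the component of [x], the detour is discarded and the path
   leaves through the exit of that visit. *)
have [|xs] := boolP (has (fun vu => conn F vu.1 x) s).
  case/hasP=> -[v u'] /= vus vx; case/splitPr: vus ss sT vs ps ps' => s1 s2 ss sT vs ps ps'.
  exists u', s2; split=> //.
  - case/andP: vs; rewrite all_cat /= => /and3P[_ vu' _] _.
    by apply: conn_trans vu'; rewrite conn_sym.
  - case/andP: vs; rewrite all_cat /= => /and3P[_ vu' h1].
    rewrite /pvalid h1 map_cat rcons_cat /= cat_uniq /= => /and5P[_ _ _ h3 h4].
    by rewrite h4 andbT (_ : cmp F u' = cmp F v) //; apply/esym/cmp_eqP.
  - by apply: subset_trans sT; exact: padd_cat.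
  - by move: ss; rewrite size_cat /=; lia.
  - move=> vu; rewrite inE => /orP[/eqP->|vs2].
      have vu' : (v, u') \in (w, u) :: s1 ++ (v, u') :: s2.
        by rewrite !(inE, mem_cat) eqxx !orbT.
      by rewrite /= mem_head /=; case/andP: (ps' _ vu').
    by apply: ps'; rewrite inE mem_cat inE vs2 !orbT.
exists x, ((w, u) :: s); split=> //=.
- by rewrite conn0.
- case/andP: vs => vs us; rewrite /pvalid /= wu vs /=.
  have <- : cmp F u = cmp F w by apply/esym/cmp_eqP.
  move: us => /= ->; rewrite andbT inE negb_or cmp_eq mem_rcons inE negb_or cmp_eq.
  rewrite xyC; apply/and3P; split=> //.
    by apply: contra xwC => xu; apply: conn_trans xu _; rewrite conn_sym.
  apply/mapP=> -[vu vus /eqP]; rewrite cmp_eq => xvu; case/negP: xs; apply/hasP.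
  by exists vu => //; rewrite conn_sym.
- by rewrite padd_setU1 subUset sub1set; apply/andP.
- move=> vu; rewrite inE => /orP[/eqP->|/ps' //]; by rewrite /= mem_head.
Qed.


End PathCover.

(** * Trees *)

Section Trees.
Variable V : finType.
Implicit Types (F E T : {set {set V}}) (e C : {set V}) (u v w x y z : V).

Lemma adj_simple T : adj (simple_mg T) =2 lnk T.
Proof. by move=> u v; rewrite /adj /= !inE /nedges /= /lnk; case: (_ \in T). Qed.

Lemma ncomps1_conn T u v : ncomps T = 1 -> conn T u v.
Proof.
move=> c1; rewrite -cmp_eq; apply: contraTT isT => ne.
suff : 1 < ncomps T by rewrite c1.
have <- : #|[set cmp T u; cmp T v]| = 2 by rewrite cards2 ne.
by apply: subset_leq_card; apply/subsetP=> C; rewrite !inE => /orP[]/eqP->; exact: cmp_in.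
Qed.

Lemma connected_simple T : connected_mg (simple_mg T) = (ncomps T == 1).
Proof.
rewrite /connected_mg /=; apply/andP/eqP => [[/set0Pn[v _] /forall_inP h]|c1].
  rewrite /ncomps (_ : comps T = [set cmp T v]) ?cards1 //.
  apply/setP=> C; rewrite inE; apply/imsetP/eqP=> [[u _ ->]|->]; last by exists v.
  apply/cmp_eqP; have := forall_inP (h u (in_setT _)) v (in_setT _).
  by rewrite (eq_connect (adj_simple T)).
split.
  have : 0 < ncomps T by rewrite c1.
  by case/card_gt0P=> C /imsetP[v _ _]; apply/set0Pn; exists v; rewrite inE.
apply/forall_inP=> u _; apply/forall_inP=> v _.
by rewrite (eq_connect (adj_simple T)); exact: ncomps1_conn.
Qed.

Lemma path_notin T e x p : path (lnk T) x p ->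
  (forall w q1 q2, p = q1 ++ w :: q2 -> [set last x q1; w] != e) ->
  path (lnk (T :\ e)) x p.
Proof.
elim: p x => //= w p IH x /andP[xw pw] h; rewrite {1}/lnk in_setD1 -/(lnk T x w).
rewrite xw (h w [::] p) //=; apply: IH => // w' q1 q2 pE.
by have := h w' (w :: q1) q2; rewrite pE /=; apply.
Qed.

(** A path joining the ends of an edge without using it closes up to a cycle of length at least 3;
    conversely the rest of a cycle joins the ends of any of its edges. *)
Lemma is_treeE T : is_tree T = forest T && (ncomps T == 1).
Proof.
rewrite /is_tree connected_simple andbCA [RHS]andbC -/(loopless T).
case: (ncomps T == 1) => //=; apply/idP/idP.
  case/andP=> lT /boolp.asboolP ac; apply/forestP; split=> // u v uvT.
  apply/negP=> /connectP[p0 pth lst].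
  case/shortenP: pth lst => p pth up _ lst.
  have vu : v != u.
    by rewrite eq_sym; have := forall_inP lT _ uvT; rewrite cards2; case: (u != v).
  have : size (u :: p) <= 2.
    apply: ac; rewrite /ucycle up andbT /= rcons_path (eq_path (adj_simple T)).
    rewrite (adj_simple T) -lst lnk_sym /lnk uvT andbT.
    by apply: sub_path pth => a b; rewrite /lnk !inE => /andP[].
  case: p pth lst {up} => [|w [|//]] /=; first by move=> _ vE; rewrite vE eqxx in vu.
  by rewrite /lnk !inE => /andP[/andP[+ _] _] wE _; rewrite wE eqxx.
move=> fT; have /andP[lT _] := fT; rewrite lT; apply/boolp.asboolP=> c /andP[].
case: c => [|u [|v [|w c]]] //; rewrite /cycle (eq_path (adj_simple T)).
move=> /= /and3P[uv vw pc]; rewrite inE negb_or => /and3P[/andP[neuv uwc] vwc ucc].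
have /andP[uw uc] : (u != w) && (u \notin c) by move: uwc; rewrite inE negb_or.
have := forest_edge fT uv; case/negP; rewrite conn_sym.
apply/connectP; exists (w :: rcons c u); last by rewrite /= last_rcons.
apply: path_notin => /=; first by rewrite vw.
(* By uniqueness of the vertices, a step along {u, v} could only be the last one, to [u]; but its
   starting point is then the end of [w :: c], which is neither [u] nor [v]. *)
move=> z q1 q2 pE; apply/eqP=> h.
have : (last v q1 \in [set u; v]) && (z \in [set u; v]) by rewrite -h !inE !eqxx orbT.
have uvc : uniq [:: v, w & rcons c u].
  have : perm_eq [:: v, w & rcons c u] [:: u, v, w & c].
    rewrite -[_ :: _ :: rcons _ _]/(rcons (v :: w :: c) u) perm_sym -cat1s -cats1.
    by rewrite perm_catC.
  move/perm_uniq=> -> /=; rewrite !inE !negb_or neuv uw uc /=.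
  by move: vwc; rewrite inE negb_or => ->.
have vq : v :: q1 ++ z :: q2 = [:: v, w & rcons c u] by rewrite -pE.
have zv : z != v by move: uvc; rewrite -vq /= mem_cat inE !negb_or eq_sym => /andP[/and3P[_ ->]].
rewrite !inE (negbTE zv) orbF => /andP[h1 /eqP zu].
have q2E : q2 = [::].
  case: (lastP q2) vq => // q2' b vq.
  have bu : b = u.
    by have := congr1 (last v) vq; rewrite /= last_cat /= last_rcons last_rcons.
  by move: uvc; rewrite -vq /= cat_uniq /= zu bu mem_rcons inE eqxx /= !andbF.
subst z q2; have q1E : q1 = w :: c.
  by move: vq => [] /(congr1 (belast v)); rewrite -rcons_cons !cats1 !belast_rcons => -[->].
move: h1; rewrite q1E /= => /orP[]/eqP lE.
  by move: uc uw neuv; have := mem_last w c; rewrite lE inE => /orP[->|->].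
by move: vwc; have := mem_last w c; rewrite lE => ->.
Qed.

Lemma deg_ge2 T w u v : u != v -> [set u; w] \in T -> [set w; v] \in T -> 1 < deg T w.
Proof.
move=> uv uw wv; rewrite /deg.
have <- : #|[set [set u; w]; [set w; v]]| = 2.
  rewrite cards2; case: eqP => // h; case/negP: uv.
  have hu : u \in [set w; v] by rewrite -h set21.
  have hv : v \in [set u; w] by rewrite h set22.
  by move: hu hv; rewrite !inE => /orP[/eqP->|//] /orP[/eqP->|/eqP->].
apply: subset_leq_card; apply/subsetP=> e; rewrite !inE.
by case/orP=> /eqP->; rewrite ?uw ?wv !inE eqxx ?orbT.
Qed.

Lemma deg_interior T x p w : path (lnk T) x p -> uniq (x :: p) ->
  w \in x :: p -> w != x -> w != last x p -> 1 < deg T w.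
Proof.
move=> pth up; rewrite inE => /orP[/eqP->|]; first by rewrite eqxx.
move=> wp _; case/splitPr: wp pth up => p1 p2 pth up; move: pth; rewrite cat_path last_cat /=.
case: p2 up => [|z p2 up]; first by rewrite eqxx.
move=> /and3P[_ pw /andP[wz _]] _.
apply: deg_ge2 pw wz; apply: contraTneq up => <-.
rewrite -cat_cons cat_uniq; apply/negP=> /and3P[_ /hasPn/(_ (last x p1)) + _].
by rewrite mem_last 2!in_cons eqxx orbT => /(_ isT).
Qed.

Lemma deg1_nbr_uniq T z u v : deg T z = 1 -> [set z; u] \in T -> [set z; v] \in T -> u = v.
Proof.
move=> dz zu zv; apply/eqP/negPn/negP=> uv; move: (uv).
by move/deg_ge2 => /(_ T z); rewrite setUC dz => /(_ zu zv).
Qed.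

Lemma conn_pathP T x y : conn T x y ->
  exists p, [/\ path (lnk T) x p, uniq (x :: p) & y = last x p].
Proof.
by case/connectP=> p0 pth ->; case/shortenP: pth => p pth up _; exists p.
Qed.

(** Two adjacent leaves would form a whole component with at most two vertices. *)
Lemma deg1_nonadj T z w : ncomps T = 1 -> 2 < #|V| -> deg T z = 1 -> deg T w = 1 ->
  [set z; w] \notin T.
Proof.
move=> c1 V3 dz dw; apply/negP=> zw.
suff : #|V| <= #|[set z; w]| by move: V3; rewrite cards2; case: (z != w); lia.
apply: subset_leq_card; apply/subsetP=> v _.
have /connectP[p pth ->] := ncomps1_conn z v c1.
suff : forall q a, a \in [set z; w] -> path (lnk T) a q -> last a q \in [set z; w].
  by apply=> //; rewrite set21.
elim=> [|u q IH] a //= az /andP[au]; apply: IH; move: az au; rewrite !inE /lnk => /orP[]/eqP-> au.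
  by rewrite (deg1_nbr_uniq dz au zw) eqxx orbT.
by rewrite setUC in zw; rewrite (deg1_nbr_uniq dw au zw) eqxx.
Qed.

End Trees.

(** * Gluing leaves *)

Section Gluing.
Variables (V : finType) (T : {set {set V}}).
Implicit Types (e : {set V}) (u v w x y z : V) (Ls : seq (V * V)).
Hypotheses (treeT : is_tree T) (V3 : 2 < #|V|).

Let lT : loopless T.
Proof. by move: treeT; rewrite is_treeE => /andP[/andP[]]. Qed.

Let cT : ncomps T = 1.
Proof. by move: treeT; rewrite is_treeE => /andP[_ /eqP]. Qed.

Definition nbr z := neighbour (simple_mg T) z.

Definition ends Ls : seq V := flatten [seq [:: p.1; p.2] | p <- Ls].

Definition leaf_pairs Ls := uniq (ends Ls) && all (fun z => deg T z == 1) (ends Ls).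

Lemma edge_nbr z : deg T z = 1 -> [set z; nbr z] \in T.
Proof.
move=> dz; rewrite /nbr /neighbour; case: pickP => [w|h] /=.
  by rewrite adj_simple.
have : 0 < deg T z by rewrite dz.
case/card_gt0P=> e; rewrite inE => /andP[eT ze].
have [u [v [_ eE]]] := looplessP lT eT; move: ze eT; rewrite eE !inE.
by case/orP=> /eqP<- uv; [have := h v|have := h u; rewrite setUC in uv];
  rewrite adj_simple /lnk uv.
Qed.

Lemma deg_nbr z : deg T z = 1 -> deg T (nbr z) != 1.
Proof.
move=> dz; apply/eqP=> dn; have := deg1_nonadj cT V3 dz dn.
by rewrite edge_nbr.
Qed.

Lemma nbr_uniq z w : deg T z = 1 -> [set z; w] \in T -> w = nbr z.
Proof. by move=> dz zw; exact: (deg1_nbr_uniq dz zw (edge_nbr dz)). Qed.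

Lemma ends_rcons Ls p : ends (rcons Ls p) = ends Ls ++ [:: p.1; p.2].
Proof. by rewrite /ends map_rcons flatten_rcons. Qed.

Lemma mem_ends Ls p : p \in Ls -> (p.1 \in ends Ls) && (p.2 \in ends Ls).
Proof.
move=> pL; apply/andP; split; apply/flattenP; exists [:: p.1; p.2];
  by rewrite ?(map_f (fun p => [:: p.1; p.2])) // !inE eqxx ?orbT.
Qed.

(** The neighbour of a leaf is never a leaf, so no gluing deletes it: the successive gluings do not
    interact and the new edges can be read off from [T]. *)
Lemma glue_allE Ls : leaf_pairs Ls ->
  verts (glue_all (simple_mg T) Ls) = [set z | z \notin ends Ls] /\
  forall e, mult (glue_all (simple_mg T) Ls) e =
    if has (mem e) (ends Ls) then 0
    else (e \in T) + count (fun p => e == upair (nbr p.1) (nbr p.2)) Ls.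
Proof.
elim/last_ind: Ls => [|Ls p IH].
  by move=> _; split=> [|e] /=; [apply/setP=> z; rewrite !inE|rewrite addn0].
rewrite /leaf_pairs ends_rcons cat_uniq all_cat => /andP[/and3P[uL uLp /= up]].
move=> /and4P[dL /eqP d1 /eqP d2 _].
have lL : leaf_pairs Ls by rewrite /leaf_pairs uL.
have [vE mE] := IH lL.
rewrite /glue_all -cats1 foldl_cat /= -/(glue_all _ _).
(* A leaf not yet glued keeps its tree neighbour, since added edges join neighbours of leaves, which
   are not leaves. *)
have nbrG z : deg T z = 1 -> z \notin ends Ls -> neighbour (glue_all (simple_mg T) Ls) z = nbr z.
  move=> dz zL; set G := glue_all _ _ in vE mE *.
  have adjG w : adj G z w = (w == nbr z).
    rewrite /adj vE !inE zL /= /nedges mE /upair; apply/andP/eqP => [[wL]|->].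
      rewrite ifN; last first.
        apply/hasPn=> a aL /=; rewrite !inE negb_or.
        by apply/andP; split; [apply: contraNneq zL => <-|apply: contraNneq wL => <-].
      case: (boolP (_ \in T)) => [|_]; first by move=> /(nbr_uniq dz).
      rewrite add0n -has_count => /hasP[q qL /eqP h].
      have /andP[q1 q2] := mem_ends qL.
      have /eqP e1 := allP dL _ q1; have /eqP e2 := allP dL _ q2.
      have : z \in [set nbr q.1; nbr q.2] by rewrite -h set21.
      by rewrite !inE => /orP[]/eqP zE; [have := deg_nbr e1|have := deg_nbr e2];
        rewrite -zE dz.
    have nL : nbr z \notin ends Ls.
      by apply/negP=> /(allP dL); apply/negP/deg_nbr.
    split=> //; rewrite ifN ?edge_nbr //.
    apply/hasPn=> a aL /=; rewrite !inE negb_or.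
    by apply/andP; split; [apply: contraNneq zL => <-|apply: contraNneq nL => <-].
  rewrite {1}/neighbour; case: pickP => [w|h] /=; first by rewrite adjG => /eqP.
  by have := h (nbr z); rewrite adjG eqxx.
have p1L : p.1 \notin ends Ls by apply: contraNN uLp => h; rewrite /= h.
have p2L : p.2 \notin ends Ls by apply: contraNN uLp => h; rewrite /= h orbT.
split=> [|e].
  by apply/setP=> z; rewrite vE !inE mem_cat !inE !negb_or andbC.
rewrite /= !nbrG // mE has_cat /= orbF count_cat /= addn0.
case: (p.1 \in e); rewrite ?orbT //; case: (p.2 \in e); rewrite ?orbT //= !orbF.
case: ifP => [/hasP[a aL /= ae]|_]; last by rewrite addnA.
rewrite add0n; case: eqP => // eE; move: ae; have /eqP da := allP dL _ aL.
by rewrite eE !inE => /orP[]/eqP aE; [have := deg_nbr d1|have := deg_nbr d2]; rewrite -aE da.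
Qed.

Definition links a q : seq {set V} := pairmap (fun u v => [set u; v]) a q.

Lemma mem_links a q e : e \in links a q ->
  exists q1 w q2, q = q1 ++ w :: q2 /\ e = [set last a q1; w].
Proof.
elim: q a => //= w q IH a; rewrite inE => /orP[/eqP->|/IH[q1 [w' [q2 [-> ->]]]]].
  by exists [::], w, q.
by exists (w :: q1), w', q2.
Qed.

Lemma links_sub a q e : e \in links a q -> {subset e <= a :: q}.
Proof.
case/mem_links=> q1 [w [q2 [-> ->]]] z; rewrite in_set2 -cat_cons mem_cat.
by case/orP=> /eqP->; rewrite ?mem_last // mem_head orbT.
Qed.

Lemma links_uniq a q : uniq (a :: q) -> uniq (links a q).
Proof.
elim: q a => //= w q IH a /andP[aq uq]; rewrite IH // andbT.
by apply/negP=> /links_sub /(_ a (set21 _ _)); apply/negP.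
Qed.

Lemma links_cat a q1 w q2 :
  links a (q1 ++ w :: q2) = links a q1 ++ [set last a q1; w] :: links w q2.
Proof. by rewrite /links pairmap_cat. Qed.

Lemma links_path a q : path (lnk T) a q -> {subset links a q <= T}.
Proof.
elim: q a => //= w q IH a /andP[aw pq] e; rewrite inE => /orP[/eqP-> //|].
exact: IH.
Qed.

Lemma adj_sym (G : multigraph V) : symmetric (adj G).
Proof.
by move=> u v; rewrite /adj /nedges /upair (setUC [set u]) andbCA.
Qed.

Lemma interior_notin_ends Ls x p w : leaf_pairs Ls -> path (lnk T) x p ->
  uniq (x :: p) -> w \in x :: p -> w != x -> w != last x p -> w \notin ends Ls.
Proof.
case/andP=> _ /allP dL pth up wp wx wy; apply/negP=> /dL /eqP dw.
by have := deg_interior pth up wp wx wy; rewrite dw.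
Qed.

Lemma mult_ge Ls u v : leaf_pairs Ls -> u \notin ends Ls -> v \notin ends Ls ->
  mult (glue_all (simple_mg T) Ls) [set u; v] = ([set u; v] \in T) +
    count (fun p => [set u; v] == upair (nbr p.1) (nbr p.2)) Ls.
Proof.
move=> lL uL vL; have [_ ->] := glue_allE lL; rewrite ifN //.
apply/hasPn=> a aL /=; rewrite !inE negb_or.
by apply/andP; split; [apply: contraNneq uL => <-|apply: contraNneq vL => <-].
Qed.

(* In the glued graph the inner vertices of the tree path between the two
   leaves form a cycle, none of whose edges is a bridge. *)
Lemma square_ge Ls x p : leaf_pairs Ls -> (x, last x p) \in Ls ->
  path (lnk T) x p -> uniq (x :: p) ->
  size p <= (square (glue_all (simple_mg T) Ls)).+1 /\ 1 < size p.
Proof.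
move=> lL xyL pth up.
have /andP[_ /allP dL] := lL.
have [xL yL] := andP (mem_ends xyL); rewrite /= in xL yL.
have /eqP dx := dL x xL; have /eqP dy := dL _ yL.
have xy : x != last x p.
  case/andP: lL => uL _; move: uL; rewrite /ends => uL.
  case/splitPr: xyL uL => L1 L2; rewrite map_cat flatten_cat cat_uniq /=.
  by case/and3P=> _ _ /andP[]; rewrite inE negb_or => /andP[].
case: p pth up xyL yL dy xy => [|a q]; first by rewrite /= eqxx.
case/lastP: q => [|q y] /=.
  rewrite andbT => xa _ _ _ da _; have := deg1_nonadj cT V3 dx da.
  by rewrite -/(lnk T x a) xa.
rewrite last_rcons size_rcons => pth up xyL yL dy xy; split => //.
rewrite ltnS; set G := glue_all _ _.
case/andP: (pth) => xa; rewrite rcons_path => /andP[pq by_]; set b := last a q in by_.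
have aE : a = nbr x by exact: nbr_uniq.
have bE : b = nbr y by apply: nbr_uniq => //; rewrite setUC.
have uaq : uniq (a :: q).
  move: up; rewrite rcons_uniq mem_rcons inE !negb_or /= -!andbA.
  by case/and5P=> _ _ _ -> /andP[_ ->]; rewrite andbT.
have aqL w : w \in a :: q -> w \notin ends Ls.
  move=> waq; apply: (@interior_notin_ends Ls x (a :: rcons q y)) => //.
  - rewrite /= in up *; rewrite inE inE mem_rcons inE.
    by move: waq; rewrite inE => /orP[]->; rewrite !orbT.
  - apply: contraTneq up => <-; rewrite inE mem_rcons inE.
    by move: waq; rewrite inE => /orP[]->; rewrite ?orbT.
  - rewrite /= last_rcons; apply: contraTneq up => <-.
    rewrite rcons_uniq mem_rcons inE.
    by move: waq; rewrite inE eq_sym => /orP[]->; rewrite ?orbT ?andbF ?andFb ?andbF.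
have [vE _] := glue_allE lL; rewrite -/G in vE.
(* The closing edge, created by gluing [x] and [y]; together with the links of [a :: q] it forms the
   cycle. *)
set ec := [set a; b].
have multG u v : u \notin ends Ls -> v \notin ends Ls ->
    ([set u; v] \in T) + ([set u; v] == ec) <= mult G [set u; v].
  move=> uL vL; rewrite mult_ge // leq_add2l; case: eqP => // ->.
  by rewrite -has_count; apply/hasP; exists (x, y) => //=; rewrite -aE -bE.
have aL := aqL a (mem_head _ _).
have bL : b \notin ends Ls by apply: aqL; exact: mem_last.
pose S := ec :: links a q.
have Sset e : e \in S -> exists u v, [/\ e = [set u; v], u \in a :: q & v \in a :: q].
  rewrite inE => /orP[/eqP->|]; first by exists a, b; rewrite mem_head mem_last.
  case/mem_links=> q1 [w [q2 [-> ->]]]; exists (last a q1), w; split=> //.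
    by rewrite -cat_cons mem_cat mem_last.
  by rewrite -cat_cons mem_cat mem_head orbT.
have conG e : e \in S -> connected_mg (remove_edge G e).
  move=> eS; rewrite /connected_mg vE; apply/andP; split.
    by apply/set0Pn; exists a; rewrite inE.
  set H := remove_edge G e.
  have csym : connect_sym (adj H) by exact/sym_connect_sym/adj_sym.
  (* Two vertices stay adjacent when the known copies of their edge, from the tree or as closing
     edge, outnumber the deleted copy; this handles double edges. *)
  have adjH u v : u \notin ends Ls -> v \notin ends Ls ->
     ([set u; v] == e) < ([set u; v] \in T) + ([set u; v] == ec) -> adj H u v.
    move=> uL vL lt; rewrite /adj /= vE !inE uL vL /= /nedges /= subn_gt0.
    exact: leq_trans lt (multG u v uL vL).
  have cT1 u v : u \notin ends Ls -> v \notin ends Ls -> [set u; v] \in T ->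
      connect (adj H) u v.
    move=> uL vL uvT; case: (eqVneq [set u; v] e) => [uve|uve]; last first.
      by apply: connect1; apply: adjH; rewrite // uvT (negbTE uve).
    case: (eqVneq e ec) => [eec|neec].
      by apply: connect1; apply: adjH; rewrite // uvT uve eec eqxx.
    (* The deleted edge is a link of the cycle: its ends are joined the other way round, through the
       closing edge. *)
    move: eS; rewrite inE (negbTE neec) /= => /mem_links [q1 [w [q2 [qE eE]]]].
    have Hpath z r : path (lnk T) z r -> {subset z :: r <= a :: q} -> e \notin links z r ->
        path (adj H) z r.
      elim: r z => //= w' r IH z /andP[zw pr] sub; rewrite inE negb_or => /andP[ne nl].
      rewrite IH //; last by move=> c cr; apply: sub; rewrite inE cr orbT.
      rewrite andbT; apply: adjH; rewrite ?aqL ?sub ?inE ?eqxx ?orbT //.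
      by rewrite -/(lnk T z w') zw eq_sym (negbTE ne).
    have := links_uniq uaq; rewrite qE links_cat -eE cat_uniq /= negb_or.
    case/and4P=> _ /andP[n1 _] n2 _.
    have := pq; rewrite qE cat_path /= => /and3P[p1 _ p2].
    have c1 : connect (adj H) a (last a q1).
      apply/connectP; exists q1 => //; apply: Hpath => // z zq.
      by rewrite qE -cat_cons mem_cat zq.
    have c2 : connect (adj H) w b.
      apply/connectP; exists q2; last by rewrite /b qE last_cat.
      by apply: Hpath => // z zq; rewrite qE -cat_cons mem_cat zq orbT.
    have c3 : connect (adj H) a b.
      by apply: connect1; apply: adjH; rewrite // -/ec eq_sym (negbTE neec) eqxx addn1.
    have c4 : connect (adj H) (last a q1) w.
      by rewrite csym in c1; apply: connect_trans c1 (connect_trans c3 _); rewrite csym.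
    have uv : u != v by have := forall_inP lT _ uvT; rewrite cards2; case: (u != v).
    move/eqP: uve; rewrite eE eq_set2 // !xpair_eqE => /orP[]/andP[/eqP<- /eqP<-] //.
    by rewrite csym.
  apply/forall_inP=> u; rewrite inE => uL; apply/forall_inP=> v; rewrite inE => vL.
  have [r [pr ur vE']] := conn_pathP (ncomps1_conn u v cT).
  (* Inner vertices of a tree path are not leaves, so the path survives the deletion of the glued
     leaves. *)
  have rL z : z \in u :: r -> z \notin ends Ls.
    move=> zr; have [->//|zu] := eqVneq z u.
    have [->|zv] := eqVneq z (last u r); first by rewrite -vE'.
    exact: interior_notin_ends pr ur zr zu zv.
  rewrite vE'; elim: r u pr rL {ur uL vE'} => //= w r IH u /andP[uw pr] rL.
  have wL : w \notin ends Ls by apply: rL; rewrite inE mem_head orbT.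
  apply: connect_trans (cT1 u w (rL u (mem_head _ _)) wL uw) (IH w pr _).
  by move=> z zr; apply: rL; rewrite inE zr orbT.
have condS e : e \in S -> [&& e \subset verts G, is_upair e & connected_mg (remove_edge G e)].
  move=> eS; rewrite conG // andbT; have [u [v [-> uq vq]]] := Sset e eS.
  rewrite /is_upair cards2; case: (u != v); rewrite andbT subUset !sub1set vE !inE !aqL //.
(* Counts the cycle with multiplicity: the closing edge is a loop if [q] is empty and doubles a link
   if [q] has one element. *)
have -> : (size q).+1 = \sum_(e : {set V}) ((e \in links a q) + (e == ec)).
  rewrite big_split /= -[X in _ + X]big_mkcond /= big_pred1_eq -[X in X + _]big_mkcond /=.
  by rewrite sum1_card (card_uniqP (links_uniq uaq)) size_pairmap addn1.
rewrite /square [leqRHS]big_mkcond /=; apply: leq_sum => e _.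
case: (boolP (e \in S)) => [eS|]; last first.
  by rewrite inE negb_or => /andP[/negbTE-> /negbTE->].
rewrite condS //; have [u [v [eE uq vq]]] := Sset e eS.
rewrite eE; apply: leq_trans (multG u v (aqL u uq) (aqL v vq)).
by rewrite leq_add2r; case: (boolP (_ \in links a q)) => // /(links_path pq)->.
Qed.

Lemma fact_succ_le c m : c <= m -> (c.+1)`! <= m.+1 ^ c.
Proof.
elim: c => // c IH cm; rewrite factS expnS leq_mul //.
by apply: IH; exact: ltnW.
Qed.

Lemma sum_count_eq (I : finType) (J : eqType) (f : I -> J) (P : pred I) (s : seq J) :
  {in P &, injective f} -> \sum_(i | P i) count (pred1 (f i)) s <= size s.
Proof.
move=> fi; rewrite (eq_bigr (fun i => \sum_(j <- s) (j == f i))); last first.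
  by move=> i _; rewrite -sum1_count big_mkcond.
rewrite exchange_big /= -sum1_size; apply: leq_sum => j _.
case: (pickP [pred i | P i & j == f i]) => [i /= /andP[Pi /eqP jE]|h]; last first.
  by rewrite big1 // => i Pi; have := h i; rewrite /= Pi /= => ->.
rewrite (bigD1 i) //= jE eqxx big1 // => i' /andP[Pi' ne].
by case: eqP => // /fi h; rewrite h ?eqxx in ne.
Qed.

(** The tree is simple, so only the k added edges matter. Loops contribute at most 2^k; an edge
    added c times has multiplicity at most c + 1, and (c+1)! <= (k+1)^c. *)
Lemma circ_le Ls : leaf_pairs Ls ->
  circ (glue_all (simple_mg T) Ls) <= (2 * (size Ls).+1) ^ size Ls.
Proof.
move=> lL; have [vE mE] := glue_allE lL; set G := glue_all _ _ in vE mE *.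
pose L := [seq upair (nbr p.1) (nbr p.2) | p <- Ls].
have mle e : mult G e <= (e \in T) + count (pred1 e) L.
  rewrite mE; case: ifP => // _; rewrite leq_add2l count_map.
  by apply: sub_count => p /=; rewrite eq_sym.
have sL : size L = size Ls by rewrite size_map.
rewrite /circ expnMn; apply: leq_mul.
  have h1 v : 2 ^ nedges G v v <= 2 ^ count (pred1 [set v]) L.
    rewrite leq_exp2l // /nedges /upair setUid; apply: leq_trans (mle _) _.
    case: (boolP (_ \in T)) => // vT.
    by have := forall_inP lT _ vT; rewrite cards1.
  apply: leq_trans (leq_prod (fun v _ => h1 v)) _; rewrite -expn_sum leq_exp2l //.
  by rewrite -sL; apply: sum_count_eq => u v _ _; exact: set1_inj.
have h2 e : (mult G e)`! <= (size Ls).+1 ^ count (pred1 e) L.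
  apply: leq_trans (fact_succ_le _); last by rewrite -sL count_size.
  by apply: leq_fact; apply: leq_trans (mle e) _; case: (_ \in T).
apply: leq_trans (leq_prod (fun e _ => h2 e)) _; rewrite -expn_sum leq_pexp2l //.
by rewrite -sL; apply: sum_count_eq => u v _ _.
Qed.

End Gluing.

(** * Real estimates *)

Local Open Scope ring_scope.

Section Estimates.
Variable R : rcfType.
Implicit Types (a x y z : R).

(** Convexity: on [0, 1] the power lies below its chord, of slope 2^q - 1. *)
Lemma exprD1_le (q : nat) y : 0 <= y <= 1 -> (1 + y) ^+ q <= 1 + 2 ^+ q * y.
Proof.
move=> /andP[y0 y1].
suff : (1 + y) ^+ q <= 1 + (2 ^+ q - 1) * y by nra.
elim: q => [|q IH]; first by rewrite !expr0 subrr mul0r addr0.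
have q1 : 1 <= 2 ^+ q :> R by apply: exprn_ege1; rewrite ler1n.
have y10 : 0 <= 1 + y by lra.
rewrite !exprS; apply: le_trans (ler_wpM2l y10 IH) _.
move: (2 ^+ q) q1 => c q1.
have : 0 <= (c - 1) * y * (1 - y) by rewrite !mulr_ge0 // subr_ge0.
nra.
Qed.

Lemma exprD_le (q : nat) x y : 0 < x -> 0 <= y <= x ->
  (x + y) ^+ q <= x ^+ q * (1 + 2 ^+ q * (y / x)).
Proof.
move=> x0 /andP[y0 yx]; have -> : x + y = x * (1 + y / x) by field; rewrite gt_eqF.
rewrite exprMn; apply: ler_wpM2l; first by rewrite exprn_ge0 // ltW.
apply: exprD1_le; rewrite (divr_ge0 y0 (ltW x0)) /=.
by rewrite ler_pdivrMr // mul1r.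
Qed.

(** From (1 + x)^b (1 - b x) <= 1, where the second factor is at least 1/2. *)
Lemma bernoulli_le (b : nat) x : 0 <= x -> b%:R * x <= 2^-1 -> (1 + x) ^+ b <= 2.
Proof.
move=> x0 bx.
have h : (1 + x) ^+ b * (1 - b%:R * x) <= 1.
  elim: b bx => [|b IH] bx; first by rewrite expr0 mul0r subr0 mul1r.
  have bx' : b%:R * x <= 2^-1 by apply: le_trans bx; rewrite ler_wpM2r // ler_nat.
  apply: le_trans (IH bx'); rewrite exprSr -mulrA ler_wpM2l ?exprn_ge0 //; first lra.
  have b0 : 0 <= b%:R :> R by []. rewrite -natr1; nra.
have p0 : 0 <= (1 + x) ^+ b by rewrite exprn_ge0 //; lra.
nra.
Qed.

(** Telescoping, by 1/sqrt(B+1) <= 2 (sqrt(B+1) - sqrt B). *)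
Lemma sum_invsqrt_le (B : nat) :
  \sum_(1 <= b < B.+1) (Num.sqrt (b%:R : R))^-1 <= 2 * Num.sqrt B%:R.
Proof.
elim: B => [|B IH]; first by rewrite big_geq // sqrtr0 mulr0.
rewrite big_nat_recr //=; apply: le_trans (lerD IH (lexx _)) _.
set u := Num.sqrt B%:R; set v := Num.sqrt B.+1%:R.
have v0 : 0 < v by rewrite sqrtr_gt0 ltr0n.
have u0 : 0 <= u by exact: sqrtr_ge0.
have uE : u ^+ 2 = B%:R by rewrite sqr_sqrtr.
have vE : v ^+ 2 = B%:R + 1 by rewrite sqr_sqrtr // natr1.
rewrite -(ler_pM2r v0) mulrDl mulVf ?gt_eqF //.
nra.
Qed.

End Estimates.

(** * Weighted sums over tuples of distinct indices *)

Section BranchingSum.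
Variables (R : rcfType) (I : finType) (d : I -> nat) (A kappa : R) (q : nat).

(* The sum over b-tuples of distinct indices outside U, with weights d i, of
   D' (A + D')^q, where D' = D + sum (d i - 1). *)
Fixpoint Hsum (b : nat) (U : {set I}) (D : R) : R :=
  if b is b'.+1 then \sum_(i | i \notin U) (d i)%:R * Hsum b' (i |: U) (D + (d i).-1%:R)
  else D * (A + D) ^+ q.

(** A falling factorial of [M] with every factor enlarged by kappa A, the price of the power of A +
    D'. *)
Definition Pprod (b M : nat) : R := \prod_(i < b) ((M - i)%:R + kappa * A).

Hypotheses (A0 : 0 < A) (hk : 2 ^+ q <= kappa)
  (hA : \sum_i (d i)%:R * (d i).-1%:R <= A ^+ 2).

Let kappa0 : 0 < kappa.
Proof. by apply: lt_le_trans hk; rewrite exprn_gt0. Qed.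

Let kA0 : 0 <= kappa * A.
Proof. by rewrite mulr_ge0 // ltW. Qed.

Lemma Pprod_ge0 b M : 0 <= Pprod b M.
Proof. by apply: prodr_ge0 => i _; rewrite addr_ge0. Qed.

Lemma PprodS b M : Pprod b.+1 M = (M%:R + kappa * A) * Pprod b M.-1.
Proof.
rewrite /Pprod big_ord_recl subn0; congr (_ * _); apply: eq_bigr => i _.
by rewrite /= /bump /=; congr (_%:R + _); lia.
Qed.

Lemma Pprod_pred b M : Pprod b M.-1 <= Pprod b M.
Proof.
by apply: ler_prod => i _; rewrite addr_ge0 //= lerD2r ler_nat; lia.
Qed.

Lemma offspring_le i : (0 < d i)%N -> (d i).-1%:R <= A.
Proof.
move=> di; have : ((d i).-1%:R : R) ^+ 2 <= A ^+ 2.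
  apply: le_trans hA; rewrite (bigD1 i) //= ler_wpDr //.
    by apply: sumr_ge0 => j _; rewrite mulr_ge0.
  by rewrite expr2 ler_wpM2r // ler_nat leq_pred.
by rewrite ler_sqr // nnegrE // ltW.
Qed.

Lemma sum_off_le (P : pred I) : \sum_(i | P i) (d i)%:R * (d i).-1%:R <= A ^+ 2.
Proof.
apply: le_trans hA; rewrite big_mkcond /=; apply: ler_sum => i _.
by case: ifP => // _; rewrite mulr_ge0.
Qed.

(** Since d_i - 1 <= A <= a, [exprD_le] linearizes the power in d_i - 1, and the linear term sums to
    at most A^2. *)
Lemma Hsum_step1 (P : pred I) (M : nat) a : A <= a -> (\sum_(i | P i) d i <= M)%N ->
  \sum_(i | P i) (d i)%:R * (a + (d i).-1%:R) ^+ q <= a ^+ q * (M%:R + kappa * A).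
Proof.
move=> Aa hM; have a0 : 0 < a by exact: lt_le_trans Aa.
apply: (@le_trans _ _ (\sum_(i | P i) a ^+ q * ((d i)%:R + kappa / A * ((d i)%:R * (d i).-1%:R)))).
  apply: ler_sum => i _; have [->|di] := posnP (d i); first by rewrite !(mul0r, mulr0, addr0).
  have dA := offspring_le di.
  have -> : a ^+ q * ((d i)%:R + kappa / A * ((d i)%:R * (d i).-1%:R)) =
     (d i)%:R * (a ^+ q * (1 + kappa * ((d i).-1%:R / A))) by field; rewrite gt_eqF.
  rewrite ler_wpM2l //; apply: le_trans (exprD_le _ a0 _) _.
    by rewrite ler0n (le_trans dA).
  rewrite ler_wpM2l ?exprn_ge0 ?(ltW a0) // lerD2l ler_pM ?exprn_ge0 //.
    by rewrite divr_ge0 // ltW.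
  by rewrite ler_wpM2l // lef_pV2.
rewrite -big_distrr /= ler_wpM2l ?exprn_ge0 ?(ltW a0) // big_split /= lerD //.
  by rewrite -natr_sum ler_nat.
rewrite -big_distrr /=; apply: (@le_trans _ _ (kappa / A * A ^+ 2)).
  by rewrite ler_wpM2l ?sum_off_le // divr_ge0 // ltW.
by rewrite expr2 mulrA divfK ?gt_eqF.
Qed.

(** Splits the factor D + (d_i - 1). The first part is [Hsum_step1]; in the second the base of the
    power is at most 2 (A + D). *)
Lemma Hsum_step2 (P : pred I) (M : nat) D : 0 <= D -> (\sum_(i | P i) d i <= M)%N ->
  \sum_(i | P i) (d i)%:R * ((D + (d i).-1%:R) * (A + (D + (d i).-1%:R)) ^+ q) <=
  (A + D) ^+ q * (D * (M%:R + kappa * A) + kappa * A ^+ 2).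
Proof.
move=> D0 hM; have a0 : 0 < A + D by rewrite ltr_wpDr.
under eq_bigr do rewrite mulrDl mulrDr addrA.
rewrite big_split /= mulrDr lerD //.
  rewrite mulrCA; under eq_bigr do rewrite mulrCA.
  rewrite -big_distrr /= ler_wpM2l // Hsum_step1 // lerDl //.
apply: (@le_trans _ _ (\sum_(i | P i) kappa * (A + D) ^+ q * ((d i)%:R * (d i).-1%:R))).
  apply: ler_sum => i _; have [->|di] := posnP (d i); first by rewrite !mul0r mulr0.
  rewrite mulrA [leRHS]mulrC ler_wpM2l ?mulr_ge0 //.
  apply: (@le_trans _ _ ((2 * (A + D)) ^+ q)).
    have dA := offspring_le di; have Y0 : 0 <= (d i).-1%:R :> R by [].
    by apply: lerXn2r; rewrite ?nnegrE; lra.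
  by rewrite exprMn ler_wpM2r // exprn_ge0 // ltW.
rewrite -big_distrr /= [leRHS]mulrCA [leRHS]mulrA; apply: ler_wpM2l (sum_off_le _).
by rewrite mulr_ge0 ?exprn_ge0 ?(ltW a0) // ltW.
Qed.

(** The part D of D' costs a factor M + kappa A per index; the part d_i - 1 of one of the b indices
    costs kappa A^2 at that index instead. [M] drops by one per choice because indices with d_i = 0
    contribute nothing. *)
Lemma Hsum_le b (U : {set I}) (M : nat) (D : R) : 0 <= D -> (\sum_(i | i \notin U) d i <= M)%N ->
  Hsum b U D <= (A + D) ^+ q * (D * Pprod b M + b%:R * kappa * A ^+ 2 * Pprod b.-1 M).
Proof.
elim: b U M D => [|b IH] U M D D0 hM /=.
  by rewrite /Pprod !big_ord0 !mul0r addr0 mulr1 mulrC.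
have aD0 : 0 <= A + D by rewrite addr_ge0 // ltW.
(* Of the two terms of the induction hypothesis, the first is summed by [Hsum_step2], the second by
   [Hsum_step1] with a = A + D. *)
apply: (@le_trans _ _ (\sum_(i | i \notin U) (Pprod b M.-1 *
    ((d i)%:R * ((D + (d i).-1%:R) * (A + (D + (d i).-1%:R)) ^+ q)) +
    b%:R * kappa * A ^+ 2 * Pprod b.-1 M.-1 *
    ((d i)%:R * ((A + D) + (d i).-1%:R) ^+ q)))).
  apply: ler_sum => i iU; have [->|di] := posnP (d i); first by rewrite !mul0r !mulr0 addr0.
  have hM' : (\sum_(j | j \notin i |: U) d j <= M.-1)%N.
    have : (d i + \sum_(j | j \notin i |: U) d j <= M)%N.
      apply: leq_trans hM; rewrite [leqRHS](bigD1 i) //= leq_add2l.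
      by rewrite (eq_bigl (fun j => (j \notin U) && (j != i))) // => j; rewrite !inE negb_or andbC.
    by lia.
  apply: le_trans (ler_wpM2l _ (IH _ M.-1 _ _ hM')) _ => //; first by rewrite addr_ge0.
  rewrite -[in leRHS](addrA A).
  by rewrite le_eqVlt; apply/orP; left; apply/eqP; ring.
rewrite big_split /= -!big_distrr /=.
have P0 := Pprod_ge0; have k0 := ltW kappa0.
apply: le_trans (lerD (ler_wpM2l (P0 _ _) (Hsum_step2 D0 hM)) (ler_wpM2l _ (Hsum_step1 _ hM))) _.
- by rewrite !mulr_ge0 ?exprn_ge0 ?(ltW A0).
- by rewrite lerDl.
have e1 : b%:R * kappa * A ^+ 2 * Pprod b.-1 M.-1 * ((A + D) ^+ q * (M%:R + kappa * A)) =
   (A + D) ^+ q * (b%:R * kappa * A ^+ 2 * Pprod b M).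
  by case: (b) => [|b']; rewrite ?mul0r ?mulr0 // PprodS; ring.
rewrite e1 PprodS -natr1.
have h : 0 <= (A + D) ^+ q * (kappa * A ^+ 2) * (Pprod b M - Pprod b M.-1).
  by rewrite !mulr_ge0 ?exprn_ge0 // ?subr_ge0 ?Pprod_pred // ltW.
rewrite -subr_ge0; apply: le_trans h _; rewrite le_eqVlt; apply/orP; left; apply/eqP; ring.
Qed.

End BranchingSum.

(** * The power 3/2 and its sum over path lengths *)

Section PowerThreeHalves.
Variable R : rcfType.

(* (s / (sg l))^(3/2) *)
Definition gfun (s sg : R) (l : nat) : R :=
  s / (sg * l%:R) * Num.sqrt (s / (sg * l%:R)).

Lemma gfun_ge0 s sg l : 0 <= s -> 0 <= sg -> 0 <= gfun s sg l.
Proof. by move=> s0 g0; rewrite mulr_ge0 ?sqrtr_ge0 // divr_ge0 // mulr_ge0. Qed.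

Lemma gfun_anti s sg (l l' : nat) : 0 <= s -> 0 < sg -> (0 < l)%N -> (l <= l')%N ->
  gfun s sg l' <= gfun s sg l.
Proof.
move=> s0 g0 l0 ll.
have h : s / (sg * l'%:R) <= s / (sg * l%:R).
  have l0' : (0 < l')%N by exact: leq_trans ll.
  by rewrite ler_wpM2l // lef_pV2 ?posrE ?mulr_gt0 ?ltr0n // ler_pM2l // ler_nat.
have h0 : 0 <= s / (sg * l'%:R) by rewrite divr_ge0 // mulr_ge0 // ltW.
by apply: ler_pM => //; rewrite ?sqrtr_ge0 // ler_wsqrtr.
Qed.

(** The bound for long paths; x^(3/2) is rounded up to x^2 as x >= 1. *)
Lemma gfun_le s sg (l : nat) x : 0 <= s -> 0 < sg -> 1 <= x -> s / sg <= x * l%:R ->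
  gfun s sg l <= x ^+ 2.
Proof.
move=> s0 g0 x1 h; have x0 : 0 <= x by lra.
have y0 : 0 <= s / (sg * l%:R) by rewrite divr_ge0 // mulr_ge0 // ltW.
have yx : s / (sg * l%:R) <= x.
  have [->|l0] := posnP l; first by rewrite mulr0 invr0 mulr0.
  by rewrite invfM mulrA ler_pdivrMr ?ltr0n.
rewrite expr2 /gfun; apply: ler_pM => //; first exact: sqrtr_ge0.
rewrite -[leRHS](ger0_norm x0) -sqrtr_sqr.
by apply: ler_wsqrtr; apply: le_trans yx _; rewrite expr2 ler_peMl.
Qed.

(** With z = s / sg the sum is z^(3/2) times that of b^(-1/2), hence at most 2 z^(3/2) sqrt B. An
    exponent 2 would give a harmonic sum here. *)
Lemma sum_gfun_le s sg (B : nat) : 0 <= s -> 0 < sg -> B%:R <= s / sg ->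
  \sum_(1 <= b < B.+1) gfun s sg b * b%:R <= 2 * (s / sg) ^+ 2.
Proof.
move=> s0 g0 hB; set z := s / sg in hB *.
have z0 : 0 <= z by rewrite divr_ge0 // ltW.
have -> : \sum_(1 <= b < B.+1) gfun s sg b * b%:R =
  z * Num.sqrt z * \sum_(1 <= b < B.+1) (Num.sqrt (b%:R : R))^-1.
  rewrite big_distrr /=; apply: eq_big_nat => b /andP[b1 _].
  have b0 : (0 : R) < b%:R by rewrite ltr0n.
  rewrite /gfun invfM mulrA -/z sqrtrM // sqrtrV ?ltW //.
  have w0 : 0 < Num.sqrt (b%:R : R) by rewrite sqrtr_gt0.
  by field; rewrite !gt_eqF.
apply: le_trans (ler_wpM2l _ (sum_invsqrt_le R B)) _; first by rewrite mulr_ge0 ?sqrtr_ge0.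
have hs : Num.sqrt (B%:R : R) <= Num.sqrt z by rewrite ler_wsqrtr.
have zz : Num.sqrt z * Num.sqrt z = z by rewrite -expr2 sqr_sqrtr.
have q0 := sqrtr_ge0 z.
have : Num.sqrt z * Num.sqrt (B%:R : R) <= z by rewrite -[leRHS]zz ler_wpM2l.
nra.
Qed.

(** All factors M - i are at least s / 2. So the enlargement by kappa A costs a factor 2 in total,
    by [bernoulli_le], and the two additional factors of the falling factorial supply s^2 / 4. *)
Lemma Pprod_ffact (A kappa s : R) (b M : nat) : 0 < s -> 0 <= kappa * A -> (0 < b)%N ->
  4 * (kappa * A) * b%:R <= s -> s <= 2 * (M - b)%:R ->
  Pprod A kappa b.-1 M * s ^+ 2 <= 8 * (M ^_ b.+1)%:R.
Proof.
case: b => // b s0 k0 _ hb hM; rewrite /= ffact_prod !big_ord_recr /= !natrM natr_prod.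
set x := kappa * A in k0 hb *.
have m1 : s <= 2 * (M - b)%:R by apply: le_trans hM _; rewrite ler_wpM2l // ler_nat; lia.
have P0 : 0 <= \prod_(i < b) (M - i)%:R :> R by apply: prodr_ge0.
have -> : 8 * (\prod_(i < b) (M - i)%:R * (M - b)%:R * (M - b.+1)%:R) =
  (\prod_(i < b) (M - i)%:R * 2) * ((2 * (M - b)%:R) * (2 * (M - b.+1)%:R)) :> R by ring.
apply: ler_pM; rewrite ?sqr_ge0 //.
- by apply: prodr_ge0 => i _; rewrite addr_ge0.
- apply: (@le_trans _ _ (\prod_(i < b) ((M - i)%:R * (1 + 2 * x / s)))).
    apply: ler_prod => i _; rewrite addr_ge0 //= mulrDr mulr1 lerD2l.
    have hi : s <= 2 * (M - i)%:R.
      by apply: le_trans m1 _; rewrite ler_wpM2l // ler_nat; have := ltn_ord i; lia.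
    have -> : (M - i)%:R * (2 * x / s) = x * ((2 * (M - i)%:R) / s) by ring.
    by rewrite ler_peMr // ler_pdivlMr // mul1r.
  rewrite big_split /= prodr_const card_ord ler_wpM2l //.
  apply: bernoulli_le; first by apply: divr_ge0; [apply: mulr_ge0|exact: ltW].
  rewrite mulrA ler_pdivrMr //.
  have : b%:R <= b.+1%:R :> R by rewrite ler_nat.
  nra.
- by rewrite expr2; apply: ler_pM => //; exact: ltW.
Qed.

End PowerThreeHalves.

(** * Sums over paths *)

Section SumSeq.
Variables (R : numDomainType) (X : finType).
Implicit Types (h : seq X -> R) (s : seq X).

(** An iterated sum over sequences of length b, whose recursion matches that of [Hsum]. *)
Fixpoint sumseq (b : nat) h : R :=
  if b is b'.+1 then \sum_x sumseq b' (fun s => h (x :: s)) else h [::].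

Lemma le_sumseq b h h' : (forall s, size s = b -> h s <= h' s) ->
  sumseq b h <= sumseq b h'.
Proof.
elim: b h h' => [|b IH] h h' hh /=; first exact: hh.
by apply: ler_sum => x _; apply: IH => s sb; apply: hh; rewrite /= sb.
Qed.

Lemma eq_sumseq b h h' : (forall s, h s = h' s) -> sumseq b h = sumseq b h'.
Proof.
elim: b h h' => [|b IH] h h' hh /=; first exact: hh.
by apply: eq_bigr => x _; apply: IH.
Qed.

Lemma sumseq_distr b h a : sumseq b (fun s => a * h s) = a * sumseq b h.
Proof.
elim: b h => [|b IH] h //=; rewrite big_distrr /=; apply: eq_bigr => x _.
exact: (IH (fun s => h (x :: s))).
Qed.

Lemma sumseq_ge0 b h : (forall s, 0 <= h s) -> 0 <= sumseq b h.
Proof.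
elim: b h => [|b IH] h h0 /=; first exact: h0.
by apply: sumr_ge0 => x _; exact: IH.
Qed.

Lemma sumseq_ge h s : (forall s, 0 <= h s) -> h s <= sumseq (size s) h.
Proof.
elim: s h => [|x s IH] h h0 //=; rewrite (bigD1 x) //= ler_wpDr //.
  by apply: sumr_ge0 => x' _; exact: sumseq_ge0.
exact: (IH (fun s => h (x :: s))).
Qed.

Lemma sum_sumseq (I : finType) (P : pred I) b (h : I -> seq X -> R) :
  \sum_(i | P i) sumseq b (h i) = sumseq b (fun s => \sum_(i | P i) h i s).
Proof.
elim: b h => [|b IH] h //=; rewrite exchange_big /=; apply: eq_bigr => x _.
exact: (IH (fun i s => h i (x :: s))).
Qed.

End SumSeq.

(** * Summing path weights over the crossing points *)

Section PathSums.
Variables (R : rcfType) (V : finType) (dg : V -> nat).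
Implicit Types (F E T : {set {set V}}) (e C : {set V}) (u v w x y : V) (s : seq (V * V)).

Local Notation ext := (ext dg).
Local Notation res := (res dg).
Local Notation resC := (resC dg).

Definition fresh F (U : {set {set V}}) s :=
  uniq [seq cmp F vu.1 | vu <- s] && all (fun C => C \notin U) [seq cmp F vu.1 | vu <- s].

(** The weight of the crossing points in the ratio of tree counts given by [path_step]; it vanishes
    if some entry and exit lie in different components. *)
Definition pw F s : R := \prod_(vu <- s)
  ((conn F vu.1 vu.2 * (res F vu.1 * (res F vu.2 - (vu.1 == vu.2))))%:R / (resC F (cmp F vu.1))%:R).

(** In the contracted tree C is a vertex of degree R_C, with R_C - 1 children. *)
Definition offspring F C := if C \in comps F then (resC F C).-1 else 0%N.

Lemma fresh_cons F U vu s : fresh F U (vu :: s) =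
  (cmp F vu.1 \notin U) && fresh F (cmp F vu.1 |: U) s.
Proof.
rewrite /fresh /=; set L := [seq _ | _ <- s]; set C := cmp F vu.1.
have -> : all (fun C' => C' \notin C |: U) L = (C \notin L) && all (fun C' => C' \notin U) L.
  elim: (L) => //= C' L' ->; rewrite !inE !negb_or (eq_sym C').
  by case: (C == C'); case: (C' \in U); case: (C \in L'); rewrite ?andbF.
by case: (C \in L); case: (uniq L); case: (C \in U); rewrite /= ?andbF.
Qed.

Lemma sum_res_cmp F v :
  (\sum_u conn F v u * (res F v * (res F u - (v == u))) = res F v * (resC F (cmp F v)).-1)%N.
Proof.
have [->|rv] := posnP (res F v).
  by rewrite mul0n big1 // => u _; rewrite mul0n muln0.
transitivity (\sum_(u in cmp F v) res F v * (res F u - (v == u)))%N.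
  rewrite [RHS]big_mkcond /=; apply: eq_bigr => u _; rewrite inE.
  by case: ifP => _; rewrite ?mul1n ?mul0n.
rewrite -big_distrr /= resC_cmp (bigD1 v) ?mem_cmp //= eqxx; congr (_ * _)%N.
rewrite (eq_bigr (res F)) => [|u /andP[_ /negbTE vu]]; last by rewrite eq_sym vu subn0.
lia.
Qed.

(** For a fixed component, summing the weight over exits and then over entries gives R_C (R_C - 1) /
    R_C, the offspring number, so only the choice of distinct components remains. *)
Lemma sumseq_Hsum F A (q b : nat) (U : {set {set V}}) (D : R) :
  sumseq b (fun s => (fresh F U s)%:R * pw F s *
    ((D + (pexcess dg F s)%:R) * (A + (D + (pexcess dg F s)%:R)) ^+ q)) =
  Hsum (offspring F) A q b U D.
Proof.
elim: b U D => [|b IH] U D /=.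
  by rewrite /fresh /pw /pexcess !big_nil /= !mul1r addr0.
pose w (vu : V * V) : R :=
  (conn F vu.1 vu.2 * (res F vu.1 * (res F vu.2 - (vu.1 == vu.2))))%:R / (resC F (cmp F vu.1))%:R.
transitivity (\sum_vu w vu * ((cmp F vu.1 \notin U)%:R *
    Hsum (offspring F) A q b (cmp F vu.1 |: U) (D + (resC F (cmp F vu.1)).-2%:R))).
  apply: eq_bigr => vu _; rewrite -IH mulrA -sumseq_distr; apply: eq_sumseq => s.
  rewrite fresh_cons /pw /pexcess !big_cons -/(w vu) natrD.
  rewrite -mulnb natrM !addrA; ring.
rewrite -(pair_big xpredT xpredT (fun v u => w (v, u) * ((cmp F v \notin U)%:R *
    Hsum (offspring F) A q b (cmp F v |: U) (D + (resC F (cmp F v)).-2%:R)))) /=.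
pose f (C : {set V}) v : R := (res F v)%:R * ((resC F C).-1%:R / (resC F C)%:R) * ((C \notin U)%:R *
    Hsum (offspring F) A q b (C |: U) (D + (resC F C).-2%:R)).
transitivity (\sum_v f (cmp F v) v).
  apply: eq_bigr => v _; rewrite -big_distrl /= /f; congr (_ * _).
  by rewrite /w /= -big_distrl /= -natr_sum sum_res_cmp natrM mulrA.
rewrite (comps_big _ F f) [RHS]big_mkcond /= [LHS]big_mkcond /=; apply: eq_bigr => C _.
rewrite /offspring /f; case: (C \in comps F); last by rewrite mul0r; case: ifP.
rewrite -!big_distrl /= -natr_sum -/(resC F C) mulrCA.
case: ifP => _; last by rewrite mul0r ?mulr0.
rewrite mul1r; have [->|R0] := posnP (resC F C); first by rewrite !mul0r.
by congr (_ * _); field; rewrite pnatr_eq0 -lt0n.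
Qed.

End PathSums.

(** * The induction on the number of pairs of leaves *)

Section MainInduction.
Variables (R : rcfType) (V : finType) (dg : V -> nat) (k : nat).
Variables (xs ys : nat -> V) (sq : nat -> {set {set V}} -> nat) (sg : R).
Hypothesis sum_dg : (\sum_v dg v = 2 * #|V|.-1)%N.
Hypotheses (k0 : (0 < k)%N) (sg1 : 1 <= sg).
Hypothesis dgx : forall i, (i < k)%N -> dg (xs i) = 1%N.
Hypothesis dgy : forall i, (i < k)%N -> dg (ys i) = 1%N.
Hypothesis xs_inj : forall i j, (i < k)%N -> (j < k)%N -> i != j ->
  [/\ xs i != xs j, ys i != ys j & xs i != ys j].
Implicit Types (F E T : {set {set V}}) (e C : {set V}) (u v w x y : V) (s : seq (V * V)).

Local Notation ext := (ext dg).
Local Notation res := (res dg).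
Local Notation resC := (resC dg).
Local Notation dtree := (dtree dg).
Local Notation size_V := (#|V|%:R : R).

(** Crossing points are not leaves, so the pairs still to be treated stay isolated in the enlarged
    forest. *)
Definition avoids s := all (fun vu => (dg vu.1 != 1%N) && (dg vu.2 != 1%N)) s.

(** The interface with gluing, supplied by [star_cover]. *)
Hypothesis cover : forall F T i, dtree T -> F \subset T -> (i < k)%N ->
  deg F (xs i) = 0%N -> deg F (ys i) = 0%N ->
  exists s, [/\ pvalid F (xs i) s (ys i), padd F (xs i) s (ys i) \subset T,
    (0 < size s <= sq i T)%N & avoids s].

(** [kappa] dominates 2^(2n) for all n <= k, as the bound on [Hsum] with q = 2n requires. Paths are
    long beyond |V| / (L A) crossed components. In [K], L^2 comes from long paths and 16 kappa from
    short ones. *)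
Let kappa : R := 4 ^+ k.
Let L : R := 16 * k%:R * kappa.
Let K : R := L ^+ 2 + 16 * kappa.
Let g := gfun size_V sg.

Lemma isolated_cmp F x : deg F x = 0%N -> cmp F x = [set x].
Proof.
move=> dx; apply/setP=> w; rewrite !inE; apply/idP/eqP=> [|->]; last exact: conn0.
case/connectP=> -[|z p] /=; first by move=> _ ->.
case/andP=> xz _ _; move: dx => /eqP; rewrite cards_eq0 => /eqP/setP/(_ [set x; z]).
by rewrite !inE eqxx andbT -/(lnk F x z) xz.
Qed.

Lemma deg_padd_eq0 F x s y z : deg F z = 0%N -> z != x -> z != y -> avoids s ->
  dg z = 1%N -> deg (padd F x s y) z = 0%N.
Proof.
move=> dz zx zy av dgz; elim: s F x dz zx av => [|vu s IH] F x dz zx /=.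
  move=> _; case: (boolP ([set x; y] \in F)) => [h|h]; last first.
    by rewrite deg_setU1 // dz !inE (negbTE zx) (negbTE zy).
  by rewrite setUC (setUidPl _) // sub1set.
case/andP=> /andP[v1 u1] av; apply: IH => //.
  case: (boolP ([set x; vu.1] \in F)) => [h|h]; last first.
    rewrite deg_setU1 // dz !inE (negbTE zx); case: eqP => // zv.
    by rewrite -zv dgz eqxx in v1.
  by rewrite setUC (setUidPl _) // sub1set.
by apply: contraNneq u1 => <-; rewrite dgz.
Qed.

Lemma pw_weight F x s y : pvalid F x s y ->
  pw R dg F s = (pweight dg F s)%:R / (\prod_(vu <- s) resC F (cmp F vu.1))%:R.
Proof.
case/andP=> /allP cs _; rewrite /pw /pweight !natr_prod -prodf_div.
apply: eq_big_seq => vu vus; by rewrite (cs _ vus) mul1n.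
Qed.

Lemma pw_ge0 F s : 0 <= pw R dg F s.
Proof. by apply: prodr_ge0 => vu _; rewrite divr_ge0. Qed.

Lemma kappa_ge1 : 1 <= kappa.
Proof. by apply: exprn_ege1; rewrite ler1n. Qed.

Lemma L_ge : 16 * kappa <= L /\ 16 * k%:R <= L.
Proof.
have k1 : 1 <= k%:R :> R by rewrite ler1n.
have := kappa_ge1; rewrite /L; move: kappa => c c1; split; nra.
Qed.

Lemma K_ge0 : 0 <= K.
Proof. by rewrite addr_ge0 ?sqr_ge0 // mulr_ge0 // (le_trans ler01 kappa_ge1). Qed.

(** The forest has used at most v / 8 edges and the path is short, so at least v / 2 components
    remain throughout. *)
Lemma count_room (c v b : nat) : (8 * (v - c) <= v)%N -> (16 * b <= v)%N -> (0 < b)%N ->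
  [/\ (b.+2 < c)%N, (1 < c)%N, (b.+1 <= c - 2)%N & (v <= 2 * (c - 2 - b))%N].
Proof. by move=> *; split; lia. Qed.

(** Applies the hypothesis for n pairs to the forest enlarged by one path, with A replaced by A +
    [pexcess], and rewrites its tree count by [path_step]. The invariant on [ncomps F] allots |V| /
    (8k) edges to each path. *)
Lemma ext_term n m F A b s (rest : {set {set V}} -> R) :
  (m + n.+1)%N = k -> sg <= A -> (exc dg F)%:R <= A ^+ 2 -> (0 < ext F)%N ->
  (forall j, (m <= j < k)%N -> deg F (xs j) = 0%N /\ deg F (ys j) = 0%N) ->
  (8 * k * (#|V| - ncomps F) <= m * #|V|)%N ->
  (0 < b)%N -> b%:R * (L * A) <= size_V ->
  size s = b -> pvalid F (xs m) s (ys m) -> avoids s ->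
  (forall P A', sg <= A' -> (exc dg P)%:R <= A' ^+ 2 ->
     (forall j, (m.+1 <= j < k)%N -> deg P (xs j) = 0%N /\ deg P (ys j) = 0%N) ->
     (8 * k * (#|V| - ncomps P) <= m.+1 * #|V|)%N ->
     \sum_(T | dtree T && (P \subset T)) rest T <= K ^+ n * (ext P)%:R * (A' / sg) ^+ (2 * n)) ->
  \sum_(T | dtree T && (padd F (xs m) s (ys m) \subset T)) rest T <=
  K ^+ n * (ext F)%:R / sg ^+ (2 * n) / ((ncomps F - 2) ^_ b.+1)%:R *
  ((fresh F set0 s)%:R * pw R dg F s *
   ((0 + (pexcess dg F s)%:R) * (A + (0 + (pexcess dg F s)%:R)) ^+ (2 * n))).
Proof.
move=> mn sgA excF eF iso cF b0 hb sb vs av IH; rewrite add0r.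
have mk : (m < k)%N by rewrite -mn -addSnnS leq_addr.
have A1 : 1 <= A by exact: le_trans sgA.
set P := padd _ _ _ _; set D : R := (pexcess dg F s)%:R.
have D0 : 0 <= D by [].
have sg0 : 0 < sg by exact: lt_le_trans sg1.
have hb16 : (16 * k * b <= #|V|)%N.
  rewrite -(ler_nat R) !natrM; apply: le_trans hb.
  have [_ L2] := L_ge; have b1 : 0 <= b%:R :> R by [].
  have kk : 0 <= k%:R :> R by []. 
  apply: (@le_trans _ _ (b%:R * L)); first by rewrite mulrC ler_wpM2l.
  rewrite ler_wpM2l // ler_peMr // (le_trans _ L2) // mulr_ge0 //.
have hc : (8 * (#|V| - ncomps F) <= #|V|)%N.
  rewrite -(leq_pmul2l k0); apply: leq_trans (leq_mul (ltnW mk) (leqnn #|V|)).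
  by apply: leq_trans cF; rewrite mulnA (mulnC k).
have hk16 : (16 * b <= 16 * k * b)%N by rewrite -mulnA leq_mul2l leq_pmull ?orbT.
have [ix iy] : deg F (xs m) = 0%N /\ deg F (ys m) = 0%N by apply: iso; rewrite leqnn.
have [c3 c2 cb _] := count_room hc (leq_trans hk16 hb16) b0.
have vfresh : fresh F set0 s.
  case/andP: vs => _ /=; rewrite rcons_uniq => /and3P[_ _ us]; rewrite /fresh us /=.
  by apply/allP=> C _; rewrite inE.
have nn : 0 <= K ^+ n * (ext F)%:R / sg ^+ (2 * n) / ((ncomps F - 2) ^_ b.+1)%:R *
  (true%:R * pw R dg F s * (D * (A + D) ^+ (2 * n))).
  have AD0 : 0 <= A + D by lra.
  by rewrite !mulr_ge0 ?invr_ge0 ?exprn_ge0 ?K_ge0 ?pw_ge0 ?(ltW sg0).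
rewrite vfresh; have [eP0|eP] := posnP (ext P).
  rewrite big1 // => T /andP[dT PT].
  have /ext_gt0P : exists2 T, dtree T & P \subset T by exists T.
  by rewrite -/P eP0.
have [|c1 e1 x1] := path_step sum_dg eP _ vs; first by rewrite sb.
have Rx : resC F (cmp F (xs m)) = 1%N.
  by rewrite isolated_cmp // resC_set1 res_deg0 // dgx.
have Ry : resC F (cmp F (ys m)) = 1%N.
  by rewrite isolated_cmp // resC_set1 res_deg0 // dgy.
have rx : res F (xs m) = 1%N by rewrite res_deg0 // dgx.
have ry : res F (ys m) = 1%N by rewrite res_deg0 // dgy.
rewrite -/P Rx Ry rx ry /= !mul1n !muln1 !add0n !addn0 sb in c1 e1 x1.
have R0 : (0 < \prod_(vu <- s) resC F (cmp F vu.1))%N.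
  rewrite big_seq prodn_cond_gt0 // => vu vus.
  by rewrite (ext_gt0_resC sum_dg) ?cmp_in.
have f0 : (0 < (ncomps F - 2) ^_ b.+1)%N by rewrite ffact_gt0.
apply: (@le_trans _ _ (K ^+ n * (ext P)%:R * ((A + D) / sg) ^+ (2 * n))).
  apply: IH; first by lra.
  (* Both leaves have missing degree 1, so the merged component has missing degree D and [exc] grows
     by at most D^2. *)
  - apply: (@le_trans _ _ (A ^+ 2 + D ^+ 2)).
      2: by have : 0 <= A * D; [rewrite mulr_ge0 //; lra|rewrite sqrrD; lra].
    apply: le_trans (lerD excF (lexx _)).
    rewrite /D -natrX -natrD ler_nat; apply: leq_trans x1 _; rewrite leq_add2l expnS expn1.
    by rewrite leq_mul // ?leq_pred // (leq_trans (leq_pred _)) ?leq_pred.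
  - move=> j /andP[mj jk]; have [|jx jy] := iso j; first by rewrite (ltnW mj).
    have jm : j != m by rewrite gtn_eqF.
    have [h1 h2 h3] := xs_inj jk mk jm.
    have [_ _ h4] : [/\ xs m != xs j, ys m != ys j & xs m != ys j].
      by apply: xs_inj => //; rewrite eq_sym.
    by split; apply: deg_padd_eq0; rewrite ?dgx ?dgy // eq_sym.
  (* The path adds b + 1 <= 2b edges, and 16 k b <= |V|. *)
  - have -> : (#|V| - ncomps P <= (#|V| - ncomps F) + b.+1 ->
        (8 * k * (#|V| - ncomps P) <= m.+1 * #|V|))%N.
      move=> h; apply: leq_trans (leq_mul (leqnn (8 * k)) h) _.
      rewrite mulnDr mulSn addnC leq_add //.
      apply: leq_trans hb16; have h2 : (b.+1 <= 2 * b)%N by rewrite mul2n -addnn -addn1 leq_add2l.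
      apply: leq_trans (leq_mul (leqnn (8 * k)) h2) _.
      by rewrite mulnCA !mulnA.
    by [].
  by rewrite c1; move: (ncomps P) (#|V|) => a c; clear; lia.
rewrite mul1r (pw_weight vs) -/D.
move: ((ncomps F - 2) ^_ b.+1)%N f0 e1 => ff f0 e1.
have := congr1 (fun a => a%:R : R) e1; rewrite !natrM -/D.
have := f0; have := R0; rewrite -!(ltr_nat R).
move: ff%:R (\prod_(_ <- _) _)%:R => f r r0' f0' e2.
have -> : K ^+ n * (ext F)%:R / sg ^+ (2 * n) / f *
     ((pweight dg F s)%:R / r * (D * (A + D) ^+ (2 * n))) =
   K ^+ n * ((ext F)%:R * (pweight dg F s)%:R * D) *
     (A + D) ^+ (2 * n) / sg ^+ (2 * n) / f / r by ring.
rewrite -e2 expr_div_n le_eqVlt; apply/orP; left; apply/eqP; field.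
by rewrite !gt_eqF // exprn_gt0.
Qed.


(** Sums [ext_term] over all paths crossing b components. The weights form [Hsum] with D = 0 and
    total offspring c - 2; dividing by the falling factorial with [Pprod_ffact] leaves the factor b
    A^2 / |V|^2. *)
Lemma sumseq_ext_le n m F A b (rest : {set {set V}} -> R) :
  (m + n.+1)%N = k -> sg <= A -> (exc dg F)%:R <= A ^+ 2 -> (0 < ext F)%N ->
  (forall j, (m <= j < k)%N -> deg F (xs j) = 0%N /\ deg F (ys j) = 0%N) ->
  (8 * k * (#|V| - ncomps F) <= m * #|V|)%N ->
  (0 < b)%N -> b%:R * (L * A) <= size_V ->
  (forall P A', sg <= A' -> (exc dg P)%:R <= A' ^+ 2 ->
     (forall j, (m.+1 <= j < k)%N -> deg P (xs j) = 0%N /\ deg P (ys j) = 0%N) ->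
     (8 * k * (#|V| - ncomps P) <= m.+1 * #|V|)%N ->
     \sum_(T | dtree T && (P \subset T)) rest T <= K ^+ n * (ext P)%:R * (A' / sg) ^+ (2 * n)) ->
  sumseq b (fun s => (pvalid F (xs m) s (ys m) && avoids s)%:R *
    \sum_(T | dtree T && (padd F (xs m) s (ys m) \subset T)) rest T) <=
  K ^+ n * (ext F)%:R * (A / sg) ^+ (2 * n) * (8 * kappa * A ^+ 2 / size_V ^+ 2) * b%:R.
Proof.
move=> mn sgA excF eF iso cF b0 hb IH.
have A0 : 0 < A by apply: lt_le_trans sgA; exact: lt_le_trans sg1.
have sg0 : 0 < sg by exact: lt_le_trans sg1.
have mk : (m < k)%N by rewrite -mn -addSnnS leq_addr.
have L1 := L_ge.
have kap1 := kappa_ge1.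
have kap0 : 0 <= kappa by exact: le_trans kap1.
have hb16 : (16 * b <= #|V|)%N.
  rewrite -(ler_nat R) natrM; apply: le_trans hb; rewrite mulrC ler_wpM2l //.
  by case: L1 => + _; have := le_trans sg1 sgA; nra.
have hc : (8 * (#|V| - ncomps F) <= #|V|)%N.
  rewrite -(leq_pmul2l k0); apply: leq_trans (leq_mul (ltnW mk) (leqnn #|V|)).
  by apply: leq_trans cF; rewrite mulnA (mulnC k).
have [c3 c2 cb room] := count_room hc hb16 b0.
set M := (ncomps F - 2)%N in cb room.
have f0 : 0 < (M ^_ b.+1)%:R :> R by rewrite ltr0n ffact_gt0.
have V0 : 0 < size_V by rewrite ltr0n; apply: leq_trans hb16; rewrite muln_gt0.
set cst := K ^+ n * (ext F)%:R / sg ^+ (2 * n) / (M ^_ b.+1)%:R.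
have cst0 : 0 <= cst by rewrite !mulr_ge0 ?invr_ge0 ?exprn_ge0 ?K_ge0 // ltW.
apply: (@le_trans _ _ (sumseq b (fun s => cst * ((fresh F set0 s)%:R * pw R dg F s *
   ((0 + (pexcess dg F s)%:R) * (A + (0 + (pexcess dg F s)%:R)) ^+ (2 * n)))))).
  apply: le_sumseq => s sb; case: (boolP (_ && _)) => [/andP[vs av]|_]; last first.
    rewrite mul0r mulr_ge0 // mulr_ge0 // ?mulr_ge0 ?pw_ge0 // add0r ?mulr_ge0 //.
    by rewrite exprn_ge0 // addr_ge0 // ltW.
  by rewrite mul1r; exact: (ext_term mn).
rewrite sumseq_distr sumseq_Hsum.
have kq : 2 ^+ (2 * n) <= kappa.
  by rewrite exprM -natrX /kappa ler_weXn2l // ?ler1n // -mn -addSnnS leq_addl.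
have dF v := ext_gt0_deg v eF.
have offE (h : nat -> nat) : h 0%N = 0%N ->
    (\sum_C h (offspring dg F C) = \sum_(C in comps F) h (resC F C).-1)%N.
  by move=> h0; rewrite [RHS]big_mkcond /=; apply: eq_bigr => C _; rewrite /offspring; case: ifP.
have hA : \sum_C (offspring dg F C)%:R * (offspring dg F C).-1%:R <= A ^+ 2.
  apply: le_trans excF; rewrite (eq_bigr (fun C => (offspring dg F C * (offspring dg F C).-1)%:R)).
    by rewrite -natr_sum (offE (fun d => d * d.-1)%N).
  by move=> C _; rewrite natrM.
have hM : (\sum_(C | C \notin set0) offspring dg F C <= M)%N.
  rewrite (eq_bigl xpredT) => [|C]; last by rewrite inE.
  rewrite (offE id) // (sum_predC sum_dg) ?(ext_gt0_forest eF) //.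
  by move=> C CF; exact: (ext_gt0_resC sum_dg).
have hH := Hsum_le A0 kq hA b (lexx 0) hM.
apply: le_trans (ler_wpM2l cst0 hH) _.
rewrite addr0 mul0r add0r.
have kA0 : 0 <= kappa * A by rewrite mulr_ge0 // ltW.
have h4 : 4 * (kappa * A) * b%:R <= size_V.
  apply: le_trans hb; rewrite mulrC ler_wpM2l // mulrA ler_wpM2r ?(ltW A0) //.
  by case: L1 => + _; lra.
have hr : size_V <= 2 * (M - b)%:R by rewrite -natrM ler_nat.
have := Pprod_ffact V0 kA0 b0 h4 hr; set Q := Pprod _ _ _ _; move: f0 => f0 hQ.
rewrite /cst; set f : R := (M ^_ b.+1)%:R in f0 hQ *.
have c1 : 0 <= K ^+ n * (ext F)%:R * (A / sg) ^+ (2 * n) *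
    (kappa * A ^+ 2 / (size_V ^+ 2 * f)) * b%:R.
  by rewrite !mulr_ge0 ?invr_ge0 ?mulr_ge0 ?exprn_ge0 ?K_ge0 ?divr_ge0
    ?(ltW A0) ?(ltW sg0) ?(ltW f0).
have -> : K ^+ n * (ext F)%:R / sg ^+ (2 * n) / f * (A ^+ (2 * n) * (b%:R * kappa * A ^+ 2 * Q)) =
  K ^+ n * (ext F)%:R * (A / sg) ^+ (2 * n) * (kappa * A ^+ 2 / (size_V ^+ 2 * f)) * b%:R *
    (Q * size_V ^+ 2).
  by rewrite expr_div_n; field; rewrite !gt_eqF // exprn_gt0.
apply: le_trans (ler_wpM2l c1 hQ) _; rewrite le_eqVlt; apply/orP; left; apply/eqP.
by field; rewrite !gt_eqF.
Qed.

(** Each tree is charged to the bound for long paths, with [F] unchanged, or to a short path it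
    contains, with [F] enlarged; the latter are summed over b by [sum_gfun_le]. *)
Theorem sum_gfun_trees n m F A :
  (m + n)%N = k -> sg <= A -> (exc dg F)%:R <= A ^+ 2 ->
  (forall j, (m <= j < k)%N -> deg F (xs j) = 0%N /\ deg F (ys j) = 0%N) ->
  (8 * k * (#|V| - ncomps F) <= m * #|V|)%N ->
  \sum_(T | dtree T && (F \subset T)) \prod_(m <= j < k) g (sq j T) <=
  K ^+ n * (ext F)%:R * (A / sg) ^+ (2 * n).
Proof.
elim: n m F A => [|n IH] m F A mn sgA excF iso cF.
  rewrite addn0 in mn; rewrite muln0 !expr0 mulr1 mul1r.
  under eq_bigr do rewrite mn big_geq //.
  by rewrite ext_sum1 natr_sum.
have [eF0|eF] := posnP (ext F).
  rewrite big1 ?eF0 ?mulr0 ?mul0r // => T /andP[dT PT].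
  have /ext_gt0P : exists2 T, dtree T & F \subset T by exists T.
  by rewrite eF0.
have sg0 : 0 < sg by exact: lt_le_trans sg1.
have A0 : 0 < A by exact: lt_le_trans sgA.
have A1 : 1 <= A by exact: le_trans sgA.
have mk : (m < k)%N by rewrite -mn -addSnnS leq_addr.
have [L1 L2] := L_ge.
have kap1 := kappa_ge1.
have Lge1 : 1 <= L by lra.
have LA1 : 1 <= L * A by nra.
have V00 : 0 <= size_V by [].
have g0 l : 0 <= g l by apply: gfun_ge0 => //; exact: ltW.
pose rest T := \prod_(m.+1 <= j < k) g (sq j T).
have rest0 T : 0 <= rest T by apply: prodr_ge0.
have IHm P A' := IH m.+1 P A' (etrans (addSnnS m n) mn).
have cF' : (8 * k * (#|V| - ncomps F) <= m.+1 * #|V|)%N.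
  by apply: leq_trans cF _; rewrite leq_mul2r leqnSn orbT.
(* B is the largest number of crossed components for which a path counts as short. *)
have exB : exists b, b%:R * (L * A) <= size_V by exists 0%N; rewrite mul0r.
have ubB b : b%:R * (L * A) <= size_V -> (b <= #|V|)%N.
  by move=> h; rewrite -(ler_nat R); apply: le_trans h; rewrite ler_peMr.
have [B hB maxB] := ex_maxnP exB ubB.
have [ix iy] : deg F (xs m) = 0%N /\ deg F (ys m) = 0%N by apply: iso; rewrite leqnn.
pose ok s := pvalid F (xs m) s (ys m) && avoids s.
pose P s := padd F (xs m) s (ys m).
(* A short covering path is one term of the sum over all valid paths, as in a union bound; a long
   one forces [sq m T] above |V| / (L A). *)
have key T : dtree T -> F \subset T -> g (sq m T) <= (L * (A / sg)) ^+ 2 +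
    \sum_(1 <= b < B.+1) g b * sumseq b (fun s => (ok s && (P s \subset T))%:R).
  move=> dT FT; have [s [vs sT /andP[s0 ssq] av]] := cover dT FT mk ix iy.
  have S0 : 0 <= \sum_(1 <= b < B.+1) g b * sumseq b (fun s => (ok s && (P s \subset T))%:R).
    by apply: sumr_ge0 => b _; rewrite mulr_ge0 // sumseq_ge0.
  have [sB|sB] := leqP (size s) B.
    apply: ler_wpDl; first exact: sqr_ge0.
    rewrite (bigD1_seq (size s)) ?iota_uniq ?mem_index_iota ?s0 //=.
    apply: ler_wpDr; first by apply: sumr_ge0 => b _; rewrite mulr_ge0 // sumseq_ge0.
    apply: (@le_trans _ _ (g (size s) * 1)); first by rewrite mulr1; apply: gfun_anti.
    rewrite ler_wpM2l //; apply: le_trans (sumseq_ge _ _) => //.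
    by rewrite /ok vs av sT.
  apply: ler_wpDr => //; apply: gfun_le => //.
    have : 1 <= A / sg by rewrite ler_pdivlMr // mul1r.
    by nra.
  rewrite -mulrA ler_pdivrMr //.
  have -> : L * (A / sg * (sq m T)%:R) * sg = (sq m T)%:R * (L * A) by field; rewrite gt_eqF.
  rewrite leNgt; apply/negP=> /ltW /maxB sqB.
  by move: (leq_trans sB (leq_trans ssq sqB)); rewrite ltnn.
set W := K ^+ n * (ext F)%:R * (A / sg) ^+ (2 * n).
have W0 : 0 <= W by rewrite !mulr_ge0 ?exprn_ge0 ?K_ge0 ?divr_ge0 // ltW.
apply: (@le_trans _ _ ((L * (A / sg)) ^+ 2 * \sum_(T | dtree T && (F \subset T)) rest T +
   \sum_(1 <= b < B.+1) g b *
     sumseq b (fun s => (ok s)%:R * \sum_(T | dtree T && (P s \subset T)) rest T))).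
  rewrite big_distrr /=; under [X in _ + X]eq_bigr do rewrite -sumseq_distr.
  rewrite (eq_bigr (fun b => \sum_(T | dtree T && (F \subset T))
      sumseq b (fun s => g b * ((ok s && (P s \subset T))%:R * rest T)))).
    rewrite exchange_big /= -big_split /=; apply: ler_sum => T /andP[dT FT].
    rewrite big_ltn // -/(rest T); apply: le_trans (ler_wpM2r (rest0 T) (key T dT FT)) _.
    rewrite mulrDl lerD2l big_distrl /= le_eqVlt; apply/orP; left; apply/eqP.
    apply: eq_bigr => b _; rewrite sumseq_distr -mulrA; congr (_ * _).
    by rewrite mulrC -sumseq_distr; apply: eq_sumseq => s; rewrite mulrC.
  move=> b _; rewrite sum_sumseq; apply: eq_sumseq => s.
  rewrite -!big_distrr /=; congr (_ * _).
  under [RHS]eq_bigr do rewrite -mulnb natrM -mulrA.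
  rewrite -big_distrr /=; congr (_ * _).
  rewrite [LHS]big_mkcond [RHS]big_mkcond /=; apply: eq_bigr => T _.
  case: (boolP (P s \subset T)) => [PT|_]; last by rewrite andbF mul0r; case: ifP.
  by rewrite (subset_trans (padd_sub _ _ _ _) PT) mul1r.
(* For long paths the pair m is skipped, with [F] and [A] unchanged. *)
have t1 : \sum_(T | dtree T && (F \subset T)) rest T <= W.
  apply: IHm => // j /andP[mj jk]; apply: iso; by rewrite (ltnW mj).
have t2 : \sum_(1 <= b < B.+1) g b *
     sumseq b (fun s => (ok s)%:R * \sum_(T | dtree T && (P s \subset T)) rest T)
   <= W * (8 * kappa * A ^+ 2 / size_V ^+ 2) * \sum_(1 <= b < B.+1) g b * b%:R.
  rewrite big_distrr /= big_nat_cond [leRHS]big_nat_cond; apply: ler_sum => b /andP[/andP[b1 bB] _].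
  rewrite [leRHS]mulrCA ler_wpM2l //; apply: sumseq_ext_le => //.
  by apply: le_trans hB; rewrite ler_wpM2r ?ler_nat ?mulr_ge0 ?(ltW A0) // (le_trans ler01).
have BV : B%:R <= size_V / sg.
  rewrite ler_pdivlMr //; apply: le_trans hB; rewrite ler_wpM2l //; nra.
have V0 : 0 < size_V.
  by rewrite ltr0n; apply/card_gt0P; exists (xs m).
have t3 := sum_gfun_le V00 sg0 BV.
apply: le_trans (lerD (ler_wpM2l (sqr_ge0 _) t1) t2) _.
have c0 : 0 <= W * (8 * kappa * A ^+ 2 / size_V ^+ 2).
  have kap0 : 0 <= kappa by exact: le_trans kap1.
  apply: mulr_ge0 => //; apply: divr_ge0; last exact: sqr_ge0.
  by apply: mulr_ge0; [apply: mulr_ge0|exact: sqr_ge0].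
apply: le_trans (lerD (lexx _) (ler_wpM2l c0 t3)) _.
(* The two contributions carry L^2 and 8 kappa * 2, whose sum is K. *)
rewrite le_eqVlt; apply/orP; left; apply/eqP.
rewrite /W mulnS (addnC 2) exprD [K ^+ n.+1]exprS.
move: (K ^+ n) ((A / sg) ^+ (2 * n)) => a c; rewrite /K.
by field; rewrite !gt_eqF.
Qed.

End MainInduction.

(** * D-trees *)

Local Open Scope nat_scope.

Section StarCover.
Variables (V : finType) (dg : V -> nat) (star : nat -> V) (k : nat).
Hypothesis V3 : 2 < #|V|.
Hypothesis dg_star : forall j, 0 < j <= 2 * k -> dg (star j) = 1.
Hypothesis star_inj : forall i j, 0 < i <= 2 * k -> 0 < j <= 2 * k -> star i = star j -> i = j.

Lemma ends_star_pairs i : ends (star_pairs star i) = [seq star j | j <- iota 1 (2 * i)].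
Proof.
elim: i => [|i IH] //; have -> : star_pairs star i.+1 =
    star_pairs star i ++ [:: (star (2 * i.+1 - 1), star (2 * i.+1))].
  by rewrite /star_pairs -[X in iota 1 X]addn1 iotaD map_cat.
rewrite /ends map_cat flatten_cat -/(ends _) IH mulnS (addnC 2) iotaD map_cat.
by congr (_ ++ _); do !congr (_ :: _); congr star; lia.
Qed.

Lemma leaf_star_pairs T i : dtree dg T -> i <= k -> leaf_pairs T (star_pairs star i).
Proof.
move=> dT ik; rewrite /leaf_pairs ends_star_pairs; apply/andP; split.
  rewrite map_inj_in_uniq ?iota_uniq // => a b; rewrite !mem_iota => ha hb.
  by apply: star_inj; lia.
apply/allP=> z /mapP[j]; rewrite mem_iota => hj ->.
by rewrite (dtree_deg _ dT) dg_star //; lia.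
Qed.

Lemma dtree_is_tree T : dtree dg T -> is_tree T.
Proof. by case/and3P=> fT cT _; rewrite is_treeE fT cT. Qed.

Lemma star_cover (F T : {set {set V}}) i : dtree dg T -> F \subset T -> i < k ->
  deg F (star (2 * i + 1)) = 0 -> deg F (star (2 * i + 2)) = 0 ->
  exists s, [/\ pvalid F (star (2 * i + 1)) s (star (2 * i + 2)),
    padd F (star (2 * i + 1)) s (star (2 * i + 2)) \subset T,
    0 < size s <= square_at star i.+1 T & avoids dg s].
Proof.
move=> dT FT ik dx dy; set x := star _ in dx *; set y := star _ in dy *.
have tT := dtree_is_tree dT.
have cT : ncomps T = 1 by case/and3P: dT => _ /eqP.
have dgx : dg x = 1 by apply: dg_star; lia.
have dgy : dg y = 1 by apply: dg_star; lia.
have xy : x != y by apply/eqP=> /star_inj; lia.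
have [p [pth up yE]] := conn_pathP (ncomps1_conn x y cT).
have xyL : (x, last x p) \in star_pairs star i.+1.
  rewrite -yE; apply/mapP; exists i.+1; first by rewrite mem_iota; lia.
  by congr (star _, star _); lia.
have [sqp _] := square_ge tT V3 (leaf_star_pairs dT ik) xyL pth up.
have xiso w : conn F x w -> w = x.
  by move=> h; have := isolated_cmp dx => /setP/(_ w); rewrite !inE h => /esym/eqP.
have yiso w : conn F w y -> w = y.
  by rewrite conn_sym => h; have := isolated_cmp dy => /setP/(_ w); rewrite !inE h => /esym/eqP.
have [u [s [/xiso-> vs sT ss ps]]] := path_cover FT pth yE yiso xy.
exists s; split=> //.
  (* [s] is shorter than the tree path, whose inner vertices number at most the square; it is
     nonempty because two leaves are not adjacent. *)
  apply/andP; split; last by rewrite -ltnS; exact: leq_trans ss sqp.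
  case: s {ps ss} vs sT => //= _; rewrite subUset sub1set => /andP[xyT _].
  have := deg1_nonadj cT V3 (z := x) (w := y).
  by rewrite !(dtree_deg _ dT) dgx dgy xyT => /(_ erefl erefl).
have deg2 w : w \in x :: p -> w != x -> w != y -> dg w != 1.
  move=> wp wx wy; have := deg_interior pth up wp wx; rewrite -yE => /(_ wy).
  by rewrite (dtree_deg _ dT); case: (dg w) => [|[]].
apply/allP=> vu vus; have hvu : vu \in (x, x) :: s by rewrite inE vus orbT.
have /andP[v1 u1] := ps vu hvu.
case/andP: vs => /allP/(_ _ vus) vuF /=; rewrite mem_rcons inE negb_or rcons_uniq.
case/andP=> /andP[_ xs] /andP[ys _].
have nx : ~~ conn F vu.1 x.
  rewrite -cmp_eq; apply: contraNneq xs => <-; exact: (map_f (fun vu => cmp F vu.1)).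
have ny : ~~ conn F vu.1 y.
  rewrite -cmp_eq; apply: contraNneq ys => <-; exact: (map_f (fun vu => cmp F vu.1)).
apply/andP; split; apply: deg2 => //.
- by apply: contraNneq nx => ->; exact: conn0.
- by apply: contraNneq ny => ->; exact: conn0.
- by apply: contraNneq nx => <-.
- by apply: contraNneq ny => <-.
Qed.

End StarCover.

(** * From degree sequences to degrees of labelled vertices *)

Section Labels.
Variable D : seq nat.
Hypotheses (degD : degree_sequence D).

Definition target (v : label D) : nat :=
  match v with inl i => (nth 0 D (val i)).+1 | inr _ => 1 end.

Lemma is_DtreeE (T : {set {set label D}}) : is_Dtree T = dtree target T.
Proof.
rewrite /is_Dtree /dtree is_treeE -!andbA; congr (_ && (_ && (_ && _))).
apply/idP/idP=> [/andP[/forallP h1 /forallP h2]|/forallP h].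
  by apply/forallP=> -[i|j]; [exact: h1|exact: h2].
by apply/andP; split; apply/forallP=> z; apply: h.
Qed.

(** The labels V_i stand for the positive entries and the stars for the zeros, [(target v).-1] being
    the entry. Positivity of [nstars D] makes its truncated subtraction exact. *)
Lemma sum_label (f : nat -> nat) : 0 < nstars D ->
  \sum_(v : label D) f (target v).-1 = \sum_(d <- D) f d.
Proof.
move=> n0; rewrite big_sumType /= sum_nat_const card_ord.
rewrite -(big_sub (fun i : 'I_(size D) => 0 < nth 0 D i) (fun i => f (nth 0 D i))).
rewrite [RHS](big_nth 0) big_mkord [RHS](bigID (fun i : 'I__ => 0 < nth 0 D i)) /=.
congr (_ + _); rewrite (eq_bigr (fun _ => f 0)) => [|i]; last by rewrite lt0n negbK => /eqP->.
rewrite sum_nat_const; congr (_ * _).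
have -> : (nstars D).+2 = count_mem 0 D by move: n0; rewrite /nstars; lia.
rewrite -sum1_count (big_nth 0) big_mkord -sum1_card; apply: eq_bigl => i.
by rewrite unfold_in /= lt0n negbK.
Qed.

Lemma card_label : 0 < nstars D -> #|{: label D}| = size D.
Proof.
move=> n0; have := sum_label (fun _ => 1) n0.
by rewrite !sum_nat_const sum1_size muln1.
Qed.

Lemma sum_target : 0 < nstars D -> \sum_(v : label D) target v = 2 * #|{: label D}|.-1.
Proof.
move=> n0; rewrite (eq_bigr (fun v => (target v).-1 + 1)) => [|[i|j] _] //=; last by rewrite addn1.
rewrite big_split /= (sum_label id n0) sum1_card card_label //.
by case: degD => _; lia.
Qed.

End Labels.

Local Open Scope ring_scope.

(** * Uniform bound on the truncated expectation *)

Section Expectation.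
Variables (R : realType) (k : nat) (D : seq nat).
Hypotheses (k0 : (0 < k)%N) (degD : degree_sequence D) (hN : (2 * k <= nstars D)%N).

Let n0 : (0 < nstars D)%N.
Proof. by apply: leq_trans hN; rewrite muln_gt0. Qed.

Let V3 : (2 < #|{: label D}|)%N.
Proof.
rewrite card_label //; case: degD => _ <-; have := count_size (pred1 0%N) D.
case: degD => _ <-; move: hN n0 k0; rewrite /nstars; lia.
Qed.

Lemma star_of_inj i j : (i <= 2 * k)%N -> (j <= 2 * k)%N ->
  star_of D i = star_of D j -> i = j.
Proof.
by rewrite /star_of => ik jk [] /(congr1 (@nat_of_ord _)); rewrite !inordK; lia.
Qed.

(** Sums d + [d = 0] <= d (d - 1) + 1 over the entries, whose total is s - 2. *)
Lemma sum_offspring_ge : (nstars D <= \sum_(d <- D) d * (d - 1))%N.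
Proof.
have h : (\sum_(d <- D) (d + (d == 0)) <= \sum_(d <- D) (d * (d - 1) + 1))%N.
  by apply: leq_sum => -[|[|d]] _ //; nia.
move: h; rewrite !big_split /= sum1_size -(big_mkcond (fun d => d == 0)%N) /= sum1_count.
rewrite (eq_count (a2 := pred1 0%N)) // /nstars; case: degD => _ <-.
move: (\sum_(_ <- D) _)%N (\sum_(_ <- D) _)%N (count_mem 0%N D) => a c d; clear; lia.
Qed.

Lemma sigma_sqr : sigma R D ^+ 2 = (\sum_(d <- D) (d * (d - 1)))%:R.
Proof. by rewrite sqr_sqrtr. Qed.

Lemma sigma_ge1 : 1 <= sigma R D.
Proof.
rewrite -sqrtr1 ler_wsqrtr // ler1n; exact: leq_trans n0 sum_offspring_ge.
Qed.

Lemma deg_set0 (V : finType) (v : V) : deg set0 v = 0%N.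
Proof. by apply/eqP; rewrite cards_eq0; apply/eqP/setP=> e; rewrite !inE. Qed.

Lemma exc_set0 : exc (@target D) set0 = (\sum_(d <- D) d * (d - 1))%N.
Proof.
rewrite -(sum_label (fun d => d * (d - 1))%N n0) /exc /comps big_imset /=; last first.
  by move=> u v _ _; rewrite !(isolated_cmp (deg_set0 _)) => /set1_inj.
apply: eq_big => [v|v _]; first by rewrite inE.
by rewrite isolated_cmp ?deg_set0 // /resC big_set1 /res deg_set0 subn0 subn1.
Qed.

(** The constant [K] of the main induction, unfolded. *)
Definition bound_const : R := (16 * k%:R * 4 ^+ k) ^+ 2 + 16 * 4 ^+ k.

(** The main induction started from the empty forest with A = sigma, where the factor A / sigma is
    1. *)
Lemma sum_gfun_Dtrees :
  \sum_(T | is_Dtree T)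
    \prod_(0 <= j < k) gfun (size D)%:R (sigma R D) (square_at (@star_of D) j.+1 T)
  <= bound_const ^+ k * #|@is_Dtree D|%:R.
Proof.
have s1 := sigma_ge1; have s0 : 0 < sigma R D by exact: lt_le_trans s1.
have inj := star_of_inj.
have dgs j : target (star_of D j) = 1%N by [].
have xs_inj i j : (i < k)%N -> (j < k)%N -> i != j ->
  [/\ star_of D (2 * i + 1) != star_of D (2 * j + 1), star_of D (2 * i + 2) != star_of D (2 * j + 2)
     & star_of D (2 * i + 1) != star_of D (2 * j + 2)].
  move=> ik jk /eqP ij; split; apply/eqP=> /inj; clear -ik jk ij; lia.
have inj' i j : (0 < i <= 2 * k)%N -> (0 < j <= 2 * k)%N -> star_of D i = star_of D j -> i = j.
  by move=> /andP[_ ik] /andP[_ jk]; exact: inj.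
have cov := star_cover V3 (fun j _ => dgs j) inj'.
have -> : #|@is_Dtree D| = ext (@target D) set0.
  by apply: eq_card => T; rewrite !inE sub0set andbT; exact: is_DtreeE.
have exc0 : (exc (@target D) set0)%:R <= sigma R D ^+ 2 by rewrite sigma_sqr exc_set0.
have iso j : (0 <= j < k)%N -> deg set0 (star_of D (2 * j + 1)) = 0%N /\
  deg set0 (star_of D (2 * j + 2)) = 0%N by split; exact: deg_set0.
have cF : (8 * k * (#|{: label D}| - ncomps (set0 : {set {set label D}})) <= 0 * #|{: label D}|)%N.
  by rewrite ncomps_set0 subnn muln0.
have := sum_gfun_trees (sum_target degD n0) k0 s1 (fun i _ => dgs _) (fun i _ => dgs _) xs_inj cov
  (add0n k) (lexx _) exc0 iso cF.
rewrite divff ?gt_eqF // expr1n mulr1 card_label //.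
by under eq_bigl do rewrite sub0set andbT -is_DtreeE.
Qed.

(** Markov's inequality for the power 3/2: sqrt(x / m) >= 1 where the cut is nonzero. *)
Lemma hcut_le (m x : R) : 0 < m -> 0 <= x -> hcut m x <= x * Num.sqrt x / Num.sqrt m.
Proof.
move=> m0 x0; rewrite /hcut; case: ifP => [mx|_]; last first.
  by rewrite mulr_ge0 ?mulr_ge0 ?invr_ge0 ?sqrtr_ge0.
by rewrite -mulrA ler_peMr // ler_pdivlMr ?sqrtr_gt0 // mul1r ler_wsqrtr.
Qed.

Lemma prod_sqrtr (I : Type) (r : seq I) (P : pred I) (f : I -> R) : (forall i, 0 <= f i) ->
  \prod_(i <- r | P i) Num.sqrt (f i) = Num.sqrt (\prod_(i <- r | P i) f i).
Proof.
move=> f0; suff [] : \prod_(i <- r | P i) Num.sqrt (f i) = Num.sqrt (\prod_(i <- r | P i) f i) /\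
  0 <= \prod_(i <- r | P i) f i by [].
apply: (big_ind2 (fun a b => a = Num.sqrt b /\ 0 <= b)) => [|a b c d [-> b0] [-> d0]|i _].
- by rewrite sqrtr1.
- by rewrite sqrtrM ?mulr_ge0.
- by [].
Qed.

Definition circ_const : R := ((2 * k.+1) ^ k)%:R.

Lemma square_square_le (T : {set {set label D}}) : is_Dtree T ->
  let X := square_square (@star_of D) R k T / lambda R D ^+ k in
  0 <= X /\ X * Num.sqrt X <= circ_const * Num.sqrt circ_const *
    \prod_(0 <= j < k) gfun (size D)%:R (sigma R D) (square_at (@star_of D) j.+1 T).
Proof.
rewrite is_DtreeE => dT X.
have s1 := sigma_ge1; have s0 : 0 < sigma R D by exact: lt_le_trans s1.
have inj' i j : (0 < i <= 2 * k)%N -> (0 < j <= 2 * k)%N -> star_of D i = star_of D j -> i = j.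
  by move=> /andP[_ ik] /andP[_ jk]; exact: star_of_inj.
have lp := leaf_star_pairs V3 (fun j _ => erefl : target (star_of D j) = 1%N) inj' dT (leqnn k).
have := circ_le (dtree_is_tree dT) V3 lp; rewrite size_map size_iota => hc.
pose y j : R := (size D)%:R / (sigma R D * (square_at (@star_of D) j.+1 T)%:R).
have y0 j : 0 <= y j by rewrite divr_ge0 // mulr_ge0 // ltW.
set Y := \prod_(0 <= j < k) y j.
have Y0 : 0 <= Y by apply: prodr_ge0.
have XE : X = (circ (glue_all (simple_mg T) (star_pairs (@star_of D) k)))%:R * Y.
  rewrite /X /square_square -mulrA; congr (_ * _).
  rewrite big_add1 /= -prodfV -exprVn /lambda invf_div mulrC.
  rewrite -[X in _ ^+ X]subn0 -prodr_const_nat -big_split /=.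
  by apply: eq_bigr => j _; rewrite /y invfM mulrA.
have X0 : 0 <= X by rewrite XE mulr_ge0.
split=> //.
have XY : X <= circ_const * Y by rewrite XE ler_wpM2r // ler_nat.
have -> : \prod_(0 <= j < k)
    gfun (size D)%:R (sigma R D) (square_at (@star_of D) j.+1 T) = Y * Num.sqrt Y.
  by rewrite big_split /= prod_sqrtr.
apply: (@le_trans _ _ ((circ_const * Y) * Num.sqrt (circ_const * Y))).
  by apply: ler_pM => //; [exact: sqrtr_ge0|exact: ler_wsqrtr].
by rewrite sqrtrM ?ler0n // mulrACA.
Qed.

Lemma unif_expectation_hcut_le (m : R) : 0 < m ->
  0 <= unif_expectation (@is_Dtree D)
    (fun T => hcut m (square_square (@star_of D) R k T / lambda R D ^+ k)) <=
  circ_const * Num.sqrt circ_const * bound_const ^+ k / Num.sqrt m.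
Proof.
move=> m0; set c := circ_const * _.
have c0 : 0 <= c by rewrite mulr_ge0 ?sqrtr_ge0 // ler0n.
have sm : 0 < Num.sqrt m by rewrite sqrtr_gt0.
have B0 : 0 <= bound_const by rewrite addr_ge0 ?sqr_ge0 // mulr_ge0 ?exprn_ge0.
rewrite /unif_expectation; apply/andP; split.
  rewrite divr_ge0 //; apply: sumr_ge0 => T dT; rewrite /hcut; case: ifP => // _.
  by case: (square_square_le dT).
(* Without any tree the quotient defining the expectation is 0 by convention. *)
have [->|n1] := posnP #|@is_Dtree D|.
  rewrite invr0 mulr0; apply: divr_ge0; last exact: ltW.
  by apply: mulr_ge0 => //; exact: exprn_ge0.
rewrite ler_pdivrMr ?ltr0n //.
apply: (@le_trans _ _ (\sum_(T | is_Dtree T) c / Num.sqrt m *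
    \prod_(0 <= j < k) gfun (size D)%:R (sigma R D) (square_at (@star_of D) j.+1 T))).
  apply: ler_sum => T dT; have [X0 hX] := square_square_le dT.
  by apply: le_trans (hcut_le m0 X0) _; rewrite [leRHS]mulrAC ler_wpM2r // invr_ge0 ltW.
rewrite -big_distrr /=.
apply: (@le_trans _ _ (c / Num.sqrt m * (bound_const ^+ k * #|@is_Dtree D|%:R))).
  by rewrite ler_wpM2l ?sum_gfun_Dtrees // divr_ge0 // ltW.
by rewrite le_eqVlt; apply/orP; left; apply/eqP; ring.
Qed.

End Expectation.

(** A star shows that the supremum is over a nonempty set; an empty one would give minus
    infinity. *)
Lemma degree_sequence_star (k : nat) :
  let D := (2 * k + 1)%N :: nseq (2 * k + 2) 0%N in
  degree_sequence D /\ (2 * k <= nstars D)%N.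
Proof.
split; [split|].
- rewrite /= path_sortedE => [|x y z]; last by move=> h1 h2; exact: leq_trans h2 h1.
  apply/andP; split; first by apply/allP=> x; rewrite mem_nseq => /andP[_ /eqP->].
  by elim: (2 * k + 2)%N => // -[].
- by rewrite big_cons big_nseq iter_addn_0 mul0n addn0 /= size_nseq; lia.
- by rewrite /nstars /= count_nseq addn1 /= mul1n; lia.
Qed.

(* Passage to the limit *)
From mathcomp Require Import all_classical all_analysis.
Import numFieldNormedType.Exports.
Local Open Scope classical_set_scope.
Local Open Scope ring_scope.

Theorem proposition5p1 (R : realType) (k : nat) (hk : (1 <= k)%N) :
  ereal_sup
    [set (unif_expectation (@is_Dtree D)
            (fun T => hcut m (square_square (@star_of D) R k T
                              / lambda R D ^+ k)))%:E
    | D in [set D : seq nat | degree_sequence D /\ (2 * k <= nstars D)%N]]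
  @[m --> (+oo : set_system R)] --> (0%:E : \bar R).
Proof.
set c := circ_const R k * Num.sqrt (circ_const R k) * bound_const R k ^+ k.
have c0 : 0 <= c.
  rewrite mulr_ge0 ?exprn_ge0 ?mulr_ge0 ?sqrtr_ge0 ?ler0n //.
  by rewrite addr_ge0 ?sqr_ge0 // mulr_ge0 ?exprn_ge0.
apply: (squeeze_cvge (f := cst 0%:E) (h := fun m => (c / Num.sqrt m)%:E)).
- near=> m; have m0 : 0 < m by near: m; exact: nbhs_pinfty_gt.
  apply/andP; split.
    have [dS nS] := degree_sequence_star k.
    have /andP[S0 _] := unif_expectation_hcut_le hk dS nS m0.
    apply: le_trans (ereal_sup_ubound _); last by exists ((2 * k + 1)%N :: nseq (2 * k + 2) 0%N).
    by rewrite lee_fin.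
  apply: ge_ereal_sup => _ [D [dD nD] <-].
  by rewrite lee_fin; case/andP: (unif_expectation_hcut_le hk dD nD m0).
- exact: cvg_cst.
- apply: cvg_EFin; first by near=> m.
  apply/cvgr0Pnorm_le => e e0; near=> m.
  have m0 : 0 < m by near: m; exact: nbhs_pinfty_gt.
  (* The threshold that makes c / sqrt m at most e. *)
  have hm : (c / e) ^+ 2 < m by near: m; apply: nbhs_pinfty_gt; exact: num_real.
  have s0 : 0 < Num.sqrt m by rewrite sqrtr_gt0.
  rewrite /= ger0_norm ?divr_ge0 ?(ltW s0) // ler_pdivrMr // mulrC -ler_pdivrMr //.
  have ce0 : 0 <= c / e by rewrite divr_ge0 // ltW.
  by rewrite -(ger0_norm ce0) -sqrtr_sqr ler_wsqrtr // ltW.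
Unshelve. all: by end_near.
Qed.
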